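(* Let $M>0$ and $0<\varepsilon'<1/3$. There exist constants $c>0$ and $\tilde C>0$ (depending on $\varepsilon'$ and the fixed $M$, but independent of $p,n,\varepsilon$) such that, for every $\varepsilon\in[0,\varepsilon']$, every $\delta\in(0,1/2)$ and all $p,n$ with $(p+\log(1/\delta))/n\le c$, $$\inf_{\boldsymbol\theta\in\mathbb{R}^p,\ \Sigma\in\mathcal{F}(M),\ P\in\mathcal{P}_\varepsilon(N_p(\boldsymbol\theta,\Sigma))}P\left(\|\hat{\boldsymbol\theta}_n-\boldsymbol\theta\|^2\le \tilde C\left(\max\left\{\frac pn,\,B_L^2(\varepsilon)\right\}+\frac{\log(1/\delta)}{n}\right)\right)\ge 1-2\delta ,$$ where $\hat{\boldsymbol\theta}_n$ is Tukey's median of an i.i.d. sample of size $n$ from $P$ and $B_L(\varepsilon)=\Phi^{-1}\!\left(\frac{1+\varepsilon}{2(1-\varepsilon)}\right)$.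
   Context: $\Phi$ is the standard normal distribution function. $\mathcal{F}(M)$ is the set of symmetric positive definite $p\times p$ matrices whose largest eigenvalue is less than $M$. $\mathcal{P}_\varepsilon(P_0^E)=\{(1-\varepsilon)P_0^E+\varepsilon G: G\text{ any distribution on }\mathbb{R}^p\}$ is the $\varepsilon$-contamination neighborhood. Tukey's depth of $\boldsymbol\theta\in\mathbb{R}^p$ with respect to $P$ is $D_T(\boldsymbol\theta,P)=\inf_{\mathbf u\in\mathbb{R}^p,\|\mathbf u\|=1}P(\mathbf u^t\mathbf X\le\mathbf u^t\boldsymbol\theta)$, and Tukey's median is $\hat{\boldsymbol\theta}_n\in\arg\max_{\boldsymbol\theta\in\mathbb{R}^p}D_T(\boldsymbol\theta,P_n)$ with $P_n$ the empirical distribution of the sample. For $p\ge 2$, $B_L(\varepsilon)$ is the asymptotic maximum bias of Tukey's median over the $\varepsilon$-contamination neighborhood at the normal model. *)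

(* Defs.v *)
From HB Require Import structures.
From mathcomp Require Export all_boot all_order all_algebra.
From mathcomp Require Export all_classical all_reals all_analysis.
Export Order.TTheory GRing.Theory Num.Theory.

Set Implicit Arguments.
Unset Strict Implicit.
Unset Printing Implicit Defensive.

Local Open Scope classical_set_scope.
Local Open Scope ring_scope.

(* Points of R^p are p.-tuples of reals: the library equips tuples with the
   product sigma-algebra, which on R^p is the Borel one. *)
Notation space R p := (p.-tuple (measurableTypeR R)).

Section euclidean.
Context {R : realType} {p : nat}.
Implicit Types u v : space R p.

Definition dotp u v : R := \sum_(i < p) tnth u i * tnth v i.
Definition norm2 v : R := Num.sqrt (dotp v v).
Definition vsub u v : space R p := [tuple tnth u i - tnth v i | i < p].

(* x |-> theta + A x *)
Definition affine (theta : space R p) (A : 'M[R]_p) (x : space R p) :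
  space R p := [tuple tnth theta i + \sum_(j < p) A i j * tnth x j | i < p].

End euclidean.

Section iid.
Context {d : measure_display} {T : measurableType d} {R : realType}.

Definition tcons (n : nat) (x : T * n.-tuple T) : n.+1.-tuple T :=
  [the n.+1.-tuple T of x.1 :: x.2].

Lemma measurable_tcons (n : nat) : measurable_fun setT (@tcons n).
Proof. exact: measurable_cons measurable_fst measurable_snd. Qed.

HB.instance Definition _ (n : nat) :=
  isMeasurableFun.Build _ _ _ _ (@tcons n) (@measurable_tcons n).

(* The n-fold product measure P^n, i.e. the law of an i.i.d. sample of size n
   from P: P^0 is the unit mass at the empty tuple, and P^(n+1) is P (x) P^n
   carried to (n+1)-tuples by consing. *)
Fixpoint iid_law (P : probability T R) (n : nat) :
    probability (n.-tuple T) R :=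
  if n is m.+1 return probability (n.-tuple T) R
  then distribution (P \x iid_law P m)%E (@tcons m)
  else \d_([tuple of [::]] : 0.-tuple T).

Definition empirical (n : nat) (x : n.-tuple T) (B : set T) : \bar R :=
  ((n%:R^-1)%:E * \sum_(i < n) \d_(tnth x i) B)%E.

End iid.

Section model.
Context {R : realType}.

Definition Phi (t : R) : R := fine (normal_prob (0 : R) 1 `]-oo, t]).

(* The inverse of Phi on its range ]0, 1[. *)
Definition Phi_inv : R -> R := 'pinv_(fun=> 0) setT Phi.

(* For p >= 2, the asymptotic maximum bias of Tukey's median over the
   eps-contamination neighborhood of N_p(0, I). *)
Definition B_L (eps : R) : R :=
  Phi_inv ((1 + eps) / (2 * (1 - eps))).

Definition posdefmx (p : nat) (S : 'M[R]_p) : Prop :=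
  S^T = S /\ forall u : 'cV[R]_p, u != 0 -> 0 < (u^T *m S *m u) 0 0.

(* All eigenvalues of a symmetric matrix being real, the largest one is less
   than M when all of those in R are. *)
Definition calF (p : nat) (M : R) : set 'M[R]_p :=
  [set S | posdefmx S /\ forall a : R, eigenvalue S a -> a < M].

(* P0 = N_p(theta, S): the law of theta + A Z, where A A^T = S and Z has
   independent standard normal coordinates. *)
Definition is_mvnormal (p : nat) (theta : space R p) (S : 'M[R]_p)
    (P0 : probability (space R p) R) : Prop :=
  exists2 A : 'M[R]_p, A *m A^T = S &
    forall B : set (space R p), measurable B ->
      P0 B = iid_law (normal_prob (0 : R) 1) p (affine theta A @^-1` B).

Definition contamination (d : measure_display) (T : measurableType d)
    (eps : R) (P0 : probability T R) : set (probability T R) :=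
  [set P | exists G : probability T R, forall B : set T, measurable B ->
    P B = ((1 - eps)%:E * P0 B + eps%:E * G B)%E].

Definition tukey_depth (p : nat) (theta : space R p)
    (P : set (space R p) -> \bar R) : \bar R :=
  ereal_inf [set P [set x | dotp u x <= dotp u theta] |
             u in [set u : space R p | norm2 u = 1]].

Definition is_tukey_median (p n : nat)
    (That : n.-tuple (space R p) -> space R p) : Prop :=
  measurable_fun setT That /\
  forall (x : n.-tuple (space R p)) (theta : space R p),
    (tukey_depth theta (empirical x) <=
     tukey_depth (That x) (empirical x))%E.

End model.

Arguments calF {R} p M _.

(* Main.v *)
From mathcomp Require Import ring lra measurable_realfun.
Require Import Defs.

(** An observation from the contaminated law is a labelled draw: with
    probability 1 - eps it is theta + A Z, where Z is standard normal and
    A A^T = S, and otherwise it comes from the contaminating law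
    ([mixture_observe]).  Hence adversarial observations only matter through
    their number, which is at most n (eps + O(h)), and everything else concerns
    the genuine vectors Z.

    Write h for the rate sqrt ((p + log (1/delta)) / n), rounded up to a power
    of 4.  The core is [uniform_halfspaces]: for a fixed level c, with high
    probability the number of genuine observations with v.Z >= c is at most
    n ((1 - eps) (1 - Phi c) + O(h)) for all unit vectors v at once.  Two levels
    suffice ([tukey_error_bound]).  With c = 0, the depth of theta in the sample
    is at least (1 - eps) / 2 - O(h), so the depth of the median is at least
    that too.  If the median were farther than sqrt M * s from theta, the
    half-space that has the median on its boundary and leaves theta out would,
    after whitening by A, lie in a half-space v.Z >= s, because the
    eigenvalues of S are below M ([quad_form_le]); with c = s its mass is then
    at most eps + (1 - eps) (1 - Phi s) + O(h).  The two bounds contradict each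
    other as soon as (1 - eps) (Phi s - 1/2) exceeds eps + O(h).  Since B_L eps
    solves (1 - eps) (Phi b - 1/2) = eps and the normal density is bounded below
    on bounded intervals, s = B_L eps + O(h) is large enough ([bias_gap]), and
    M s^2 has the announced order.

    A union bound over a single net of the sphere would cost an extra factor
    sqrt (log (n / p)), so the uniform bound is proved by chaining
    ([chaining_bound]) along nets of radius 8^-k.  The projection of Z on any
    vector w is normal with standard deviation norm2 w ([normal_dotp]), so two
    half-spaces whose normals are 8^-k apart differ with probability O(4^-k),
    and the deviations at the successive levels sum to O(h).  The chain stops at
    radius 8^-K = h^(3/2), where the second moments of the sample in all
    directions ([opnorm_event]) show that replacing v by its net point changes
    the count by O(n h) only. *)
Set Implicit Arguments.
Unset Strict Implicit.
Unset Printing Implicit Defensive.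
Import numFieldNormedType.Exports.
Local Open Scope classical_set_scope.
Local Open Scope ring_scope.

(** * Exponential inequalities for i.i.d. samples *)

Section iid_law_theory.
Context {d : measure_display} {T : measurableType d} {R : realType}.
Local Open Scope ereal_scope.

Lemma sum_tcons (g : T -> R) n (x : T) (y : n.-tuple T) :
  (\sum_(i < n.+1) g (tnth (tcons (x, y)) i))%R =
  (g x + \sum_(i < n) g (tnth y i))%R.
Proof.
rewrite big_ord_recl tnth0; congr (_ + _)%R.
by apply: eq_bigr => i _; rewrite /tcons (tnthS x y).
Qed.

Lemma measurable_tcons_section n (B : set (n.+1.-tuple T)) (x : T) :
  measurable B -> measurable [set y | B (tcons (x, y))].
Proof.
move=> mB.
have m1 : measurable_fun [set: n.-tuple T] (fun y : n.-tuple T => (x, y)).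
  exact: pair1_measurable.
have mc : measurable_fun setT (fun y => @tcons d T n (x, y)).
  by apply: measurableT_comp m1; exact: measurable_tcons.
by rewrite -[X in measurable X]setTI; exact: mc.
Qed.

Lemma iid_lawS (P : probability T R) n (B : set (n.+1.-tuple T)) :
  iid_law P n.+1 B = \int[P]_x (iid_law P n [set y | B (tcons (x, y))]).
Proof.
rewrite /= /distribution /pushforward /product_measure1; apply: eq_integral => x _ /=.
by congr (iid_law P n _); apply/seteqP; split=> y /=; rewrite /xsection/= inE.
Qed.

Lemma measurable_iid_section (P : probability T R) n (B : set (n.+1.-tuple T)) :
  measurable B ->
  measurable_fun [set: T] (fun x => iid_law P n [set y | B (tcons (x, y))] : \bar R).
Proof.
move=> mB.
have mB' : measurable (@tcons d T n @^-1` B).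
  by rewrite -[X in measurable X]setTI; exact: measurable_tcons.
have := measurable_fun_xsection (iid_law P n) mB'.
apply: eq_measurable_fun => x _ /=.
by congr (iid_law P n _); apply/seteqP; split=> y /=; rewrite /xsection/= inE.
Qed.

(** The exponential moment of a sum is bounded along the recursive definition of
    the i.i.d. law: conditionally on the first draw x the threshold drops by
    g x, and integrating the factor expR (g x) produces one factor m. *)
Lemma iid_law_chernoff (P : probability T R) (g : T -> R) (m : R) n (a : R) :
  measurable_fun setT g ->
  \int[P]_x (expR (g x))%:E <= m%:E ->
  iid_law P n [set x | (a <= \sum_(i < n) g (tnth x i))%R]
    <= (expR (- a) * m ^+ n)%:E.
Proof.
move=> mg hm.
elim: n a => [|n IH] a.
  rewrite expr0 mulr1 /= diracE lee_fin.
  have [|] := boolP (_ \in _).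
    rewrite inE /= big_ord0 => a0; rewrite /=.
    have := expR_ge1Dx (- a)%R; move/(le_trans _); apply; lra.
  by rewrite /= expR_ge0.
rewrite iid_lawS.
have mS : measurable [set x : n.+1.-tuple T | (a <= \sum_(i < n.+1) g (tnth x i))%R].
  rewrite -[X in measurable X]setTI; apply: measurable_fun_le => //.
  apply: measurable_sum => i; apply: measurableT_comp => //; exact: measurable_tnth.
have m0 : (0 <= m)%R.
  by rewrite -lee_fin; apply: le_trans hm; apply: integral_ge0 => x _; rewrite lee_fin expR_ge0.
have mE : measurable_fun setT (fun x => (expR (g x))%:E).
  by apply/measurable_EFinP; exact: measurableT_comp.
have c0 : 0 <= (expR (- a) * m ^+ n)%:E by rewrite lee_fin mulr_ge0 ?expR_ge0 ?exprn_ge0.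
apply: (@le_trans _ _ (\int[P]_x ((expR (- a) * m ^+ n)%:E * (expR (g x))%:E))).
  apply: ge0_le_integral => //.
  - exact: measurable_iid_section.
  - by apply: emeasurable_funM => //.
  - move=> x _.
    rewrite [X in iid_law P n X](_ : _ =
      [set y : n.-tuple T | (a - g x <= \sum_(i < n) g (tnth y i))%R]); last first.
      by apply/seteqP; split=> y /=; rewrite sum_tcons lerBlDl.
    by apply: le_trans (IH _) _; rewrite -EFinM lee_fin opprB addrC expRD mulrAC.
have -> : \int[P]_x ((expR (- a) * m ^+ n)%:E * (expR (g x))%:E) =
    (expR (- a) * m ^+ n)%:E * \int[P]_x (expR (g x))%:E.
  by apply: ge0_integralZl => // x _; rewrite lee_fin expR_ge0.
apply: le_trans (lee_wpmul2l c0 hm) _.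
by rewrite -EFinM lee_fin exprSr mulrA.
Qed.

End iid_law_theory.

Lemma measurable_map_tuple (d d' : measure_display) (T : measurableType d)
  (T' : measurableType d') (f : T -> T') n : measurable_fun setT f ->
  measurable_fun setT (fun x : n.-tuple T => map_tuple f x).
Proof.
move=> mf; apply/measurable_fun_tnthP => i.
rewrite (_ : _ \o _ = f \o (fun x => tnth x i)); last first.
  by apply/funext => x /=; rewrite tnth_map.
by apply: measurableT_comp => //; exact: measurable_tnth.
Qed.

Lemma iid_law_map (d d' : measure_display) (T : measurableType d)
  (T' : measurableType d') (R : realType) (f : T -> T')
  (Q : probability T R) (P : probability T' R) n :
  measurable_fun setT f ->
  (forall B, measurable B -> P B = Q (f @^-1` B)) ->
  forall B, measurable B ->
    iid_law P n B = iid_law Q n [set x : n.-tuple T | B (map_tuple f x)].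
Proof.
move=> mf PQ; elim: n => [|n IH] B mB.
  rewrite /= !diracE; congr (_%:R%:E); congr (nat_of_bool _).
  by apply/idP/idP; rewrite !inE/=; congr B; exact: val_inj.
rewrite !iid_lawS.
rewrite (eq_measure_integral (pushforward Q f))/=; last by move=> A mA _; exact: PQ.
rewrite ge0_integral_pushforward//=; last exact: measurable_iid_section.
apply: eq_integral => x _ /=; rewrite IH; last exact: measurable_tcons_section.
congr (iid_law Q n _); apply/seteqP; split=> y /=;
 by congr B; apply: val_inj.
Qed.

Section counting.
Context {d : measure_display} {T : measurableType d} {R : realType}.

Definition cnt (U : set T) n (x : n.-tuple T) : R :=
  \sum_(i < n) \1_U (tnth x i).

Lemma measurable_sum_tnth (g : T -> R) n : measurable_fun setT g ->
  measurable_fun setT (fun x : n.-tuple T => \sum_(i < n) g (tnth x i)).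
Proof.
move=> mg; apply: measurable_sum => i.
by apply: measurableT_comp => //; exact: measurable_tnth.
Qed.

Lemma measurable_cnt (U : set T) n : measurable U ->
  measurable_fun setT (fun x : n.-tuple T => cnt U x).
Proof. by move=> mU; apply: measurable_sum_tnth; exact: measurable_indic. Qed.

Lemma expR_quad (th : R) : 0 <= th <= 2^-1 -> expR th <= 1 + th + 2 * th ^+ 2.
Proof.
move=> /andP[th0 th1].
have h : 1 - th <= expR (- th) by exact: expR_ge1Dx.
have h0 : 0 < 1 - th by lra.
rewrite -[th in expR th]opprK expRN.
apply: (@le_trans _ _ (1 - th)^-1).
  by rewrite lef_pV2 ?posrE ?expR_gt0.
rewrite -[leLHS]mul1r ler_pdivrMr//; nra.
Qed.

Lemma expRN_quad (th : R) : 0 <= th -> expR (- th) <= 1 - th + th ^+ 2.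
Proof.
move=> th0; have h : 1 + th <= expR th by exact: expR_ge1Dx.
have h0 : 0 < 1 + th by lra.
rewrite expRN; apply: (@le_trans _ _ (1 + th)^-1).
  by rewrite lef_pV2 ?posrE ?expR_gt0.
by rewrite -[leLHS]mul1r ler_pdivrMr//; nra.
Qed.

(** The variance term is the probability of the union of U and V only, so the
    deviation of a difference of counts is small when U and V are the two parts
    of the symmetric difference of two close events.  The Chernoff parameter th
    is left free, since each level of the chain needs its own. *)
Lemma bernstein_diff (P : probability T R) (U V : set T) n (th lam : R) :
  measurable U -> measurable V -> U `&` V = set0 -> 0 <= th <= 2^-1 ->
  (iid_law P n [set x | (n%:R * (fine (P U) - fine (P V) + lam)
                        <= cnt U x - cnt V x)%R]
   <= (expR (- (n%:R * (th * lam - 2 * th ^+ 2 * (fine (P U) + fine (P V))))))%:E)%E.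
Proof.
move=> mU mV UV /andP[th0 th1].
set pU := fine (P U); set pV := fine (P V).
have PU : P U = pU%:E by rewrite fineK// fin_num_measure.
have PV : P V = pV%:E by rewrite fineK// fin_num_measure.
have pU0 : 0 <= pU by rewrite fine_ge0.
have pV0 : 0 <= pV by rewrite fine_ge0.
pose W := ~` (U `|` V).
have mW : measurable W by apply: measurableC; exact: measurableU.
have PW : P W = (1 - (pU + pV))%:E.
  rewrite probability_setC; last exact: measurableU.
  by have /= -> := measureU P mU mV UV; rewrite PU PV.
pose g x : R := th * (\1_U x - \1_V x).
(* g takes only the values th, - th and 0, so its exponential is a combination
   of three indicators. *)
have gE x : expR (g x) = expR (- th) * \1_V x + (expR th * \1_U x + \1_W x).
  rewrite /g !indicE.
  have [xU|xU] := boolP (x \in U); have [xV|xV] := boolP (x \in V).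
  - by move: xU xV; rewrite !inE => xU xV; have : (U `&` V) x by []; rewrite UV.
  - rewrite memNset; last by rewrite /W/=; move: xU; rewrite inE; tauto.
    by rewrite /= subr0 !mulr1 mulr0 add0r addr0.
  - rewrite memNset; last by rewrite /W/=; move: xV; rewrite inE; tauto.
    by rewrite /= sub0r mulrN !mulr1 mulr0 !addr0.
  - rewrite mem_set; last by rewrite /W/=; move: xU xV; rewrite !notin_setE; tauto.
    by rewrite /= subrr !mulr0 expR0 !add0r.
pose m := expR (th * (pU - pV) + 2 * th ^+ 2 * (pU + pV)).
have mg : measurable_fun setT g.
  by apply: measurable_funM => //; apply: measurable_funB; exact: measurable_indic.
have hm : (\int[P]_x (expR (g x))%:E <= m%:E)%E.
  under eq_integral do rewrite gE 2!EFinD.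
  have i1 (c : R) (A : set T) : measurable A -> 0 <= c ->
     (\int[P]_x (c * \1_A x)%:E = c%:E * P A)%E.
    move=> mA c0; under eq_integral do rewrite EFinM.
    rewrite ge0_integralZl_EFin//; last by apply/measurable_EFinP; exact: measurable_indic.
    by rewrite integral_indic// setIT.
  have mi (c : R) (A : set T) : measurable A -> measurable_fun setT (fun x => (c * \1_A x)%:E).
    by move=> mA; apply/measurable_EFinP; apply: measurable_funM => //; exact: measurable_indic.
  have mi1 (A : set T) : measurable A -> measurable_fun setT (fun x => (\1_A x : R)%:E).
    by move=> mA; apply/measurable_EFinP; exact: measurable_indic.
  rewrite ge0_integralD//=; last 3 first.
  - exact: mi.
  - by move=> x _; rewrite -EFinD lee_fin addr_ge0// mulr_ge0 ?expR_ge0.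
  - by apply: emeasurable_funD; [exact: mi|exact: mi1].
  rewrite ge0_integralD//=; last 2 first.
  - exact: mi.
  - exact: mi1.
  rewrite !i1 ?expR_ge0// integral_indic// setIT PU PV [X in (_ + (_ + X))%E]PW -!EFinM -!EFinD lee_fin.
  rewrite /m; apply: le_trans (expR_ge1Dx _).
  have h1 := @expR_quad th; have h2 := expRN_quad th0.
  rewrite th0 th1 in h1; have {}h1 := h1 isT.
  have k1 := ler_wpM2r pU0 h1; have k2 := ler_wpM2r pV0 h2.
  have k3 : th ^+ 2 * pV >= 0 by rewrite mulr_ge0 ?sqr_ge0.
  lra.
have := @iid_law_chernoff _ _ _ P g m n (th * (n%:R * (pU - pV + lam))) mg hm.
have -> : expR (- (th * (n%:R * (pU - pV + lam)))) * m ^+ n =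
    expR (- (n%:R * (th * lam - 2 * th ^+ 2 * (pU + pV)))).
  by rewrite /m -expRM_natl -expRD; congr expR; ring.
apply: le_trans; apply: le_measure; rewrite ?inE.
- rewrite -[X in measurable X]setTI; apply: measurable_fun_le => //.
  by apply: measurable_funB; exact: measurable_cnt.
- rewrite -[X in measurable X]setTI; apply: measurable_fun_le => //.
  exact: measurable_sum_tnth.
- move=> x /= h; rewrite /g -mulr_sumr; apply: ler_wpM2l => //.
  by rewrite sumrB.
Qed.

Lemma fine_diff (Q : probability T R) (A B : set T) : measurable A -> measurable B ->
  fine (Q (A `\` B)) - fine (Q (B `\` A)) = fine (Q A) - fine (Q B).
Proof.
move=> mA mB.
have E (X Y : set T) : measurable X -> measurable Y ->
    fine (Q X) = fine (Q (X `\` Y)) + fine (Q (X `&` Y)).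
  move=> mX mY; have mXY := measurableI _ _ mX mY; have mD := measurableD mX mY.
  by rewrite -fineD ?fin_num_measure// -measureDI.
by rewrite (E A B)// (E B A)// (setIC B A); lra.
Qed.

Lemma cnt_diff (A B : set T) n (x : n.-tuple T) :
  cnt (A `\` B) x - cnt (B `\` A) x = cnt A x - cnt B x :> R.
Proof.
rewrite /cnt -!sumrB; apply: eq_bigr => i _; rewrite !indicE !in_setD.
by case: (_ \in A); case: (_ \in B); rewrite /= ?subr0 ?subrr.
Qed.

Lemma cnt_setU_le (A B C : set T) n (y : n.-tuple T) : A `<=` B `|` C ->
  cnt A y <= cnt B y + cnt C y :> R.
Proof.
move=> ABC; rewrite /cnt -big_split; apply: ler_sum => i _ /=; rewrite !indicE.
have [|_] := boolP (_ \in A); last by rewrite addr_ge0.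
rewrite inE => /ABC[H|H]; first by rewrite (mem_set H) lerDl.
by rewrite (mem_set H) lerDr.
Qed.

End counting.

Section union_bound.
Context {d : measure_display} {T : measurableType d} {R : realType}.

Lemma union_bound (P : probability T R) (I : eqType) (s : seq I) (C : pred I)
  (E : I -> set T) (c : R) : 0 <= c ->
  (forall i, i \in s -> C i -> measurable (E i) /\ (P (E i) <= c%:E)%E) ->
  exists B, [/\ measurable B, (P B <= ((size s)%:R * c)%:E)%E &
    forall i, i \in s -> C i -> E i `<=` B].
Proof.
move=> c0; elim: s => [|a s IH] h.
  by exists set0; split=> //; rewrite measure0 mul0r.
have [i si Ci|B [mB PB sB]] := IH _; first by apply: h => //; rewrite inE si orbT.
have [Ca|Ca] := boolP (C a); last first.
  exists B; split=> //.
    by apply: le_trans PB _; rewrite lee_fin/= ler_wpM2r// ler_nat.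
  move=> i; rewrite inE => /orP[/eqP -> |si Ci]; first by rewrite (negbTE Ca).
  exact: sB.
have [|mE PE] := h a _ Ca; first by rewrite inE eqxx.
exists (E a `|` B); split; first exact: measurableU.
  apply: le_trans (measureU2 _ mE mB) _.
  by rewrite /= -natr1 mulrDl mul1r addrC EFinD; exact: leeD.
move=> i; rewrite inE => /orP[/eqP -> _ x|si Ci x Ex]; first by left.
by right; exact: (sB i).
Qed.

End union_bound.

(** * Euclidean geometry of tuples *)

Section euclidean_algebra.
Context {R : realType} {p : nat}.
Implicit Types u v w z : space R p.

Definition vscale (c : R) u : space R p := [tuple c * tnth u i | i < p].

Lemma dotp_vsubl u v z : dotp (vsub u v) z = dotp u z - dotp v z.
Proof.
rewrite /dotp -sumrB; apply: eq_bigr => i _.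
by rewrite tnth_mktuple mulrBl.
Qed.

Lemma dotpC u v : dotp u v = dotp v u.
Proof. by apply: eq_bigr => i _; rewrite mulrC. Qed.

Lemma dotp_vsubr u v z : dotp z (vsub u v) = dotp z u - dotp z v.
Proof. by rewrite dotpC dotp_vsubl !(dotpC _ z). Qed.

Lemma dotp_vscalel c u z : dotp (vscale c u) z = c * dotp u z.
Proof.
by rewrite /dotp mulr_sumr; apply: eq_bigr => i _; rewrite tnth_mktuple mulrA.
Qed.

Lemma norm2_vscale c u : norm2 (vscale c u) = `|c| * norm2 u.
Proof.
by rewrite /norm2 dotp_vscalel dotpC dotp_vscalel mulrA -expr2 sqrtrM ?sqr_ge0// sqrtr_sqr.
Qed.

Lemma norm2_vsubC u v : norm2 (vsub u v) = norm2 (vsub v u).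
Proof.
by congr Num.sqrt; apply: eq_bigr => i _; rewrite !tnth_mktuple; ring.
Qed.

Lemma dotpp_ge0 u : 0 <= dotp u u.
Proof. by apply: sumr_ge0 => i _; rewrite -expr2 sqr_ge0. Qed.

Lemma norm2_sqr u : norm2 u ^+ 2 = dotp u u.
Proof. by rewrite sqr_sqrtr// dotpp_ge0. Qed.

Lemma norm2_ge0 u : 0 <= norm2 u.
Proof. exact: sqrtr_ge0. Qed.

Lemma norm2_eq0 u : norm2 u = 0 -> forall z, dotp u z = 0.
Proof.
move=> u0 z; have : dotp u u = 0 by rewrite -norm2_sqr u0 expr0n.
move/eqP; rewrite psumr_eq0; last by move=> i _; rewrite -expr2 sqr_ge0.
move=> /allP h; apply: big1 => i _.
have := h i (mem_index_enum _); rewrite mulf_eq0 orbb => /eqP ->.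
by rewrite mul0r.
Qed.

Lemma norm2_normalize u : 0 < norm2 u -> norm2 (vscale (norm2 u)^-1 u) = 1.
Proof. by move=> u0; rewrite norm2_vscale gtr0_norm ?invr_gt0// mulVf// gt_eqF. Qed.

Lemma dotp_le_norm u v : dotp u v <= norm2 u * norm2 v.
Proof.
have [u0|u0] := eqVneq (norm2 u) 0; first by rewrite norm2_eq0// u0 mul0r.
have [v0|v0] := eqVneq (norm2 v) 0.
  by rewrite dotpC norm2_eq0// v0 mulr0.
have {}u0 : 0 < norm2 u by rewrite lt_def u0 norm2_ge0.
have {}v0 : 0 < norm2 v by rewrite lt_def v0 norm2_ge0.
pose a := vscale (norm2 u)^-1 u; pose b := vscale (norm2 v)^-1 v.
have := dotpp_ge0 (vsub a b).
rewrite dotp_vsubl !dotp_vsubr -!norm2_sqr !norm2_normalize// (dotpC b a) => h.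
have {h} : dotp a b <= 1 by lra.
rewrite /a /b dotp_vscalel dotpC dotp_vscalel mulrCA mulrA (dotpC v).
by rewrite -invfM ler_pdivrMl ?mulr_gt0// mulr1 (mulrC (norm2 v)).
Qed.

Lemma dotp_sqr_le u v : dotp u v ^+ 2 <= norm2 u ^+ 2 * norm2 v ^+ 2.
Proof.
rewrite -exprMn -[leLHS]real_normK ?num_real// lerXn2r ?nnegrE ?mulr_ge0 ?norm2_ge0//.
rewrite ler_norml dotp_le_norm andbT.
have := dotp_le_norm (vscale (- 1) u) v.
by rewrite dotp_vscalel norm2_vscale normrN1 mul1r mulN1r; lra.
Qed.

Lemma norm2_add u v w : (forall i, tnth w i = tnth u i + tnth v i) ->
  norm2 w <= norm2 u + norm2 v.
Proof.
move=> h; rewrite -[leRHS]ger0_norm ?addr_ge0 ?norm2_ge0// -sqrtr_sqr.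
rewrite ler_wsqrtr// sqrrD !norm2_sqr.
have -> : dotp w w = dotp u u + dotp u v *+ 2 + dotp v v.
  rewrite /dotp -sumrMnl -!big_split/=; apply: eq_bigr => i _.
  by rewrite h mulr2n; ring.
by rewrite lerD2r lerD2l lerMn2r/= dotp_le_norm.
Qed.

Lemma norm2_triangle u v w : norm2 (vsub u v) <= norm2 (vsub u w) + norm2 (vsub w v).
Proof. by apply: norm2_add => i; rewrite !tnth_mktuple; ring. Qed.

(** Net points lie only near the sphere, and this is what replaces the norm
    being 1 in the anti-concentration and moment bounds. *)
Lemma norm2_near_unit u v : norm2 v = 1 -> norm2 (vsub v u) <= 2^-1 ->
  2^-1 <= norm2 u <= 2.
Proof.
move=> v1 uv.
have h1 : norm2 v <= norm2 (vsub v u) + norm2 u.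
  by apply: norm2_add => i; rewrite !tnth_mktuple; ring.
have h2 : norm2 u <= norm2 (vsub u v) + norm2 v.
  by apply: norm2_add => i; rewrite !tnth_mktuple; ring.
by rewrite norm2_vsubC in h2; apply/andP; split; lra.
Qed.

End euclidean_algebra.

(** * The standard normal law and its projections *)

Section gaussian.
Context {R : realType}.
Local Notation mu := (@lebesgue_measure R).
Local Notation N := (normal_prob (0 : R) 1).
Local Notation phi := (normal_pdf (0 : R) 1).

Lemma measurable_affine (a b : R) :
  measurable_fun setT (fun t : measurableTypeR R => a + b * t : measurableTypeR R).
Proof. by apply: measurable_funD => //; apply: measurable_funM. Qed.

Lemma lebesgue_integral_affine (a b : R) (f : measurableTypeR R -> \bar R) :
  0 < b -> measurable_fun setT f -> (forall y, (0 <= f y)%E) ->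
  (\int[mu]_y f y = \int[mu]_t (b%:E * f (a + b * t)%R))%E.
Proof.
move=> b0 mf f0.
pose T (t : measurableTypeR R) : measurableTypeR R := a + b * t.
have mT : measurable_fun setT T by exact: measurable_affine.
have E A : measurable A -> mu A = mscale (NngNum (ltW b0)) (pushforward mu T) A.
  move: A; apply: lebesgue_measure_unique => //= X [[x y]] _ <-.
  rewrite /mscale /= /pushforward.
  have -> : T @^-1` `]x, y] = `](x - a) / b, (y - a) / b]%classic.
    apply/seteqP; split=> t /=; rewrite !in_itv/= ltr_pdivrMr// ler_pdivlMr// ltrBlDl lerBrDl;
    by rewrite /T [t * b]mulrC.
  rewrite !lebesgue_measure_itv/= !lte_fin ltr_pM2r ?invr_gt0// ltrBlDr subrK.
  case: ifP => _; rewrite ?mule0// -!EFinD -EFinM; congr _%:E; field.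
  by rewrite gt_eqF.
rewrite (eq_measure_integral (mscale (NngNum (ltW b0)) (pushforward mu T)))//=; last first.
  by move=> A mA _; exact: E.
rewrite ge0_integral_mscale//= ge0_integral_pushforward//= preimage_setT.
rewrite -ge0_integralZl_EFin//; last exact: ltW.
by apply: measurableT_comp.
Qed.

(** The density is the Radon-Nikodym derivative almost everywhere, because both
    have the same integrals over measurable sets. *)
Lemma normal_integral (f : R -> \bar R) :
  measurable_fun setT f -> (forall y, (0 <= f y)%E) ->
  (\int[N]_x f x = \int[mu]_x (f x * (phi x)%:E))%E.
Proof.
move=> mf f0.
have dom := @normal_prob_dominates R 0 1.
rewrite -(Radon_Nikodym_SigmaFinite.change_of_variables dom)//.
have mg := measurable_int _ (Radon_Nikodym_SigmaFinite.f_integrable dom).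
have mphi : measurable_fun setT (fun x => (phi x)%:E).
  by apply/measurable_EFinP; exact: measurable_normal_pdf.
apply: ge0_ae_eq_integral => //.
- exact: emeasurable_funM.
- exact: emeasurable_funM.
- by move=> x _; rewrite mule_ge0// Radon_Nikodym_SigmaFinite.f_ge0.
- by move=> x _; rewrite mule_ge0// lee_fin normal_pdf_ge0.
- have : ae_eq mu setT (Radon_Nikodym_SigmaFinite.f N mu) (fun x => (phi x)%:E).
    apply: integral_ae_eq => //.
      exact: Radon_Nikodym_SigmaFinite.f_integrable.
    by move=> E _ mE; rewrite -Radon_Nikodym_SigmaFinite.f_integral.
  by apply: filterS => x /= h xT; rewrite h.
Qed.

Lemma normal_affineE (a b : R) (B : set (measurableTypeR R)) : 0 < b -> measurable B ->
  N [set t | B (a + b * t)] = (\int[mu]_(y in B) (b^-1 * phi ((y - a) / b))%:E)%E.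
Proof.
move=> b0 mB.
have mphi : measurable_fun setT (fun x => (phi x)).
  exact: measurable_normal_pdf.
have mh : measurable_fun setT (fun y : measurableTypeR R => (b^-1 * phi ((y - a) / b))%:E).
  apply/measurable_EFinP; apply: measurable_funM => //.
  apply: (measurableT_comp mphi); apply: measurable_funM => //.
  by apply: measurable_funB.
rewrite [RHS]integral_mkcond (lebesgue_integral_affine a b0); last 2 first.
- by apply/(measurable_restrictT _ mB); exact: measurable_funTS mh.
- by move=> y; rewrite patchE; case: ifP => // _; rewrite lee_fin mulr_ge0 ?normal_pdf_ge0// invr_ge0 ltW.
rewrite /normal_prob [LHS]integral_mkcond; apply: eq_integral => t _.
rewrite !patchE/=; have [|] := boolP (a + b * t \in B) => tB.
  rewrite mem_set; last by rewrite inE in tB.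
  rewrite -EFinM; congr _%:E; rewrite mulrA divff ?gt_eqF// mul1r; congr phi.
  by rewrite addrC addKr mulrC mulKf ?gt_eqF.
rewrite memNset ?mule0//; by move=> h; rewrite mem_set in tB.
Qed.

Lemma normal_pdf01E (x : R) :
  phi x = (Num.sqrt (pi *+ 2))^-1 * expR (- x ^+ 2 / 2).
Proof.
rewrite normal_pdfE ?oner_neq0// /normal_peak /normal_fun expr1n mul1r subr0.
by [].
Qed.

(** Completing the square: as a function of x, the joint density of X and
    Y = a X + b X' is the density of Y times a normal density, the conditional
    density of X given Y = y. *)
Lemma normal_pdf_product (a b x y : R) : 0 < b ->
  let c := Num.sqrt (a ^+ 2 + b ^+ 2) in
  b^-1 * phi ((y - a * x) / b) * phi x =
  c^-1 * phi (y / c) * normal_pdf (a * y / c ^+ 2) (b / c) x.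
Proof.
move=> b0 c.
have c20 : 0 < a ^+ 2 + b ^+ 2 by rewrite ltr_wpDl ?sqr_ge0// exprn_gt0.
have c0 : 0 < c by rewrite sqrtr_gt0.
have c2E : c ^+ 2 = a ^+ 2 + b ^+ 2 by rewrite sqr_sqrtr ?ltW.
have bc0 : 0 < b / c by rewrite divr_gt0.
rewrite !normal_pdf01E normal_pdfE ?gt_eqF// /normal_peak /normal_fun.
rewrite -mulrnAr sqrtrM ?sqr_ge0// sqrtr_sqr gtr0_norm//.
set S := Num.sqrt (pi *+ 2).
have S0 : 0 < S by rewrite sqrtr_gt0 pmulrn_rgt0 ?pi_gt0.
have -> : b^-1 * (S^-1 * expR (- ((y - a * x) / b) ^+ 2 / 2)) * (S^-1 * expR (- x ^+ 2 / 2)) =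
   (b * S * S)^-1 * (expR (- ((y - a * x) / b) ^+ 2 / 2) * expR (- x ^+ 2 / 2)).
  by field; rewrite !gt_eqF.
have -> : c^-1 * (S^-1 * expR (- (y / c) ^+ 2 / 2)) *
   ((b / c * S)^-1 * expR (- (x - a * y / c ^+ 2) ^+ 2 / ((b / c) ^+ 2 *+ 2))) =
   (b * S * S)^-1 * (expR (- (y / c) ^+ 2 / 2) *
    expR (- (x - a * y / c ^+ 2) ^+ 2 / ((b / c) ^+ 2 *+ 2))).
  by field; rewrite !gt_eqF.
rewrite -!expRD; congr (_ * expR _).
rewrite -mulr_natr !expr_div_n c2E.
by field; rewrite !gt_eqF.
Qed.

(** a X + b X' has the law of sqrt (a^2 + b^2) X for independent standard normal
    X and X': exchange the integrals and integrate out the conditional density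
    of [normal_pdf_product]. *)
Lemma normal_conv (a b : R) (B : set (measurableTypeR R)) : 0 < b -> measurable B ->
  (\int[N]_x N [set t | B (a * x + b * t)%R] =
   N [set t | B (Num.sqrt (a ^+ 2 + b ^+ 2) * t)%R])%E.
Proof.
move=> b0 mB; set c := Num.sqrt _.
have c0 : 0 < c by rewrite sqrtr_gt0 ltr_wpDl ?sqr_ge0// exprn_gt0.
have mphi : measurable_fun setT (fun x => (phi x)).
  exact: measurable_normal_pdf.
have -> : [set t | B (c * t)] = [set t | B (0 + c * t)].
  by apply/seteqP; split=> t /=; rewrite add0r.
rewrite normal_affineE//.
have mE : measurable_fun setT (fun x : measurableTypeR R =>
    N [set t | B (a * x + b * t)] : \bar R).
  have mA : measurable [set xt : measurableTypeR R * measurableTypeR R | B (a * xt.1 + b * xt.2)].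
    have mf : measurable_fun setT (fun xt : measurableTypeR R * measurableTypeR R => a * xt.1 + b * xt.2 : measurableTypeR R).
      by apply: measurable_funD; apply: measurable_funM => //.
    by rewrite -[X in measurable X]setTI; exact: mf.
  have := measurable_fun_xsection N mA.
  apply: eq_measurable_fun => x _ /=.
  by congr (N _); apply/seteqP; split=> y /=; rewrite /xsection/= inE.
rewrite normal_integral//.
pose k (xy : measurableTypeR R * measurableTypeR R) : \bar R :=
  (\1_B xy.2 * (b^-1 * phi ((xy.2 - a * xy.1) / b) * phi xy.1))%:E.
have mk : measurable_fun setT k.
  apply/measurable_EFinP; apply: measurable_funM.
    by apply: measurableT_comp => //; exact: measurable_indic.
  apply: measurable_funM; last by apply: measurableT_comp.
  apply: measurable_funM => //; apply: (measurableT_comp mphi).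
  apply: measurable_funM => //; apply: measurable_funB => //.
  by apply: measurable_funM.
transitivity (\int[mu]_x \int[mu]_y k (x, y))%E.
  apply: eq_integral => x _.
  rewrite normal_affineE// [X in (X * _)%E]integral_mkcond -ge0_integralZr//.
  - apply: eq_integral => y _; rewrite patchE /k/= indicE; case: ifP => _.
      by rewrite mul1r EFinM.
    by rewrite mul0r mul0e.
  - apply/(measurable_restrictT _ mB); apply: measurable_funTS.
    apply/measurable_EFinP; apply: measurable_funM => //.
    apply: (measurableT_comp mphi); apply: measurable_funM => //.
    by apply: measurable_funB.
  - by move=> y _; rewrite patchE; case: ifP => // _; rewrite lee_fin mulr_ge0 ?normal_pdf_ge0// invr_ge0 ltW.
  - by rewrite lee_fin normal_pdf_ge0.
rewrite fubini_tonelli//; last first.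
  by move=> xy; rewrite lee_fin !mulr_ge0 ?normal_pdf_ge0// invr_ge0 ltW.
rewrite [RHS]integral_mkcond; apply: eq_integral => y _.
rewrite patchE /k/= subr0.
under eq_integral do rewrite (normal_pdf_product _ _ _ b0) mulrA EFinM.
rewrite ge0_integralZl_EFin//.
- rewrite integral_normal_pdf mule1 indicE; case: ifP => _; by rewrite ?mul1r ?mul0r.
- by move=> x _; rewrite lee_fin normal_pdf_ge0.
- by apply/measurable_EFinP; exact: measurable_normal_pdf.
- by rewrite !mulr_ge0 ?normal_pdf_ge0// invr_ge0 ltW.
Qed.

Lemma normal_pdfN (x : R) : phi (- x) = phi x.
Proof. by rewrite !normal_pdf01E sqrrN. Qed.

Lemma normal_sym (B : set (measurableTypeR R)) : measurable B ->
  N [set t | B (- t)] = N B.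
Proof.
move=> mB; rewrite /normal_prob.
have mN : measurable_fun setT (-%R : measurableTypeR R -> measurableTypeR R) by [].
rewrite [RHS](eq_measure_integral (pushforward mu (-%R : measurableTypeR R -> measurableTypeR R)))//=; last first.
  by move=> A mA _; apply/esym/lebesgue_measureN.
rewrite ge0_integral_pushforward//=.
- by apply: eq_integral => x _ /=; rewrite normal_pdfN.
- by apply: measurable_funTS; apply/measurable_EFinP; exact: measurable_normal_pdf.
- by move=> y _; rewrite lee_fin normal_pdf_ge0.
Qed.

Lemma normal_norm (a : R) (B : set (measurableTypeR R)) : measurable B ->
  N [set t | B (a * t)] = N [set t | B (`|a| * t)].
Proof.
move=> mB; have [a0|a0] := leP 0 a; first by rewrite ger0_norm.
rewrite ltr0_norm// -[LHS]normal_sym.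
  by congr (N _); apply/seteqP; split=> t /=; rewrite mulrN mulNr.
have := @measurable_affine 0 a measurableT B mB.
rewrite setTI; congr measurable; apply/seteqP; split=> t /=; by rewrite add0r.
Qed.

Lemma dotp_tcons p (w : space R p.+1) (x : R) (y : space R p) :
  dotp w (tcons (x, y)) = thead w * x + dotp [tuple of behead w] y.
Proof.
rewrite /dotp big_ord_recl; congr (_ * _ + _).
  apply: eq_bigr => i _; rewrite [in LHS](tuple_eta w) tnthS.
by rewrite /tcons (tnthS x y).
Qed.

Lemma measurable_dotp p (w : space R p) : measurable_fun setT (fun z : space R p => dotp w z : measurableTypeR R).
Proof.
apply: measurable_sum => i; apply: measurable_funM => //.
exact: measurable_tnth.
Qed.

(** Stated as the law of norm2 w * X, which covers w = 0 as well, where the normal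
    law with standard deviation norm2 w would be degenerate. *)
Lemma normal_dotp p (w : space R p) (B : set (measurableTypeR R)) : measurable B ->
  iid_law N p [set z | B (dotp w z)] = N [set t | B (norm2 w * t)].
Proof.
elim: p w B => [|p IH] w B mB.
  have dE (z : space R 0) : dotp w z = 0 by rewrite /dotp big_ord0.
  rewrite /= diracE /norm2 dE sqrtr0.
  have [B0|B0] := pselect (B 0).
    rewrite mem_set; last by rewrite /= dE.
    rewrite (_ : [set t | _] = setT) ?probability_setT//.
    by apply/seteqP; split=> // t _ /=; rewrite mul0r.
  rewrite memNset; last by rewrite /= dE.
  rewrite (_ : [set t | _] = set0) ?measure0//.
  by apply/seteqP; split=> // t /=; rewrite mul0r.
rewrite iid_lawS.
set w' := [tuple of behead w].
have mT (x : R) : measurable [set t : measurableTypeR R | B (thead w * x + t)].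
  have := @measurable_affine (thead w * x) 1 measurableT B mB.
  by rewrite setTI; congr measurable; apply/seteqP; split=> t /=; rewrite mul1r.
have -> : (\int[N]_x iid_law N p [set y | [set z | B (dotp w z)] (tcons (x, y))] =
           \int[N]_x N [set t | B (thead w * x + norm2 w' * t)%R])%E.
  apply: eq_integral => x _ /=.
  rewrite -(IH w' [set t | B (thead w * x + t)] (mT x)).
  by congr (iid_law N p _); apply/seteqP; split=> y /=; rewrite dotp_tcons.
have wE : norm2 w = Num.sqrt (thead w ^+ 2 + norm2 w' ^+ 2).
  rewrite norm2_sqr /norm2; congr Num.sqrt.
  have /= <- := dotp_tcons w (thead w) w'.
  by congr dotp; rewrite [LHS]tuple_eta.
(* If the tail of w vanishes, only the first coordinate is left, and its sign is
   absorbed by the symmetry of the normal law. *)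
have := norm2_ge0 w'; rewrite le_eqVlt => /orP[/eqP w'0|w'0]; last first.
  by rewrite normal_conv// wE.
rewrite wE -w'0 expr0n addr0 sqrtr_sqr -normal_norm//.
have mB' : measurable [set t : measurableTypeR R | B (thead w * t)].
  have := @measurable_affine 0 (thead w) measurableT B mB.
  by rewrite setTI; congr measurable; apply/seteqP; split=> t /=; rewrite add0r.
transitivity (\int[N]_x (\1_[set t : measurableTypeR R | B (thead w * t)] x)%:E)%E; last first.
  by rewrite integral_indic// setIT.
apply: eq_integral => x _.
rewrite indicE /=; have [xB|xB] := pselect (B (thead w * x)).
  rewrite mem_set// (_ : [set t | _] = setT) ?probability_setT//.
  by apply/seteqP; split=> // t _ /=; rewrite mul0r addr0.
rewrite memNset// (_ : [set t | _] = set0) ?measure0//.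
by apply/seteqP; split=> // t /=; rewrite mul0r addr0.
Qed.

End gaussian.

Section gaussian_bounds.
Context {R : realType}.
Local Notation mu := (@lebesgue_measure R).
Local Notation N := (normal_prob (0 : R) 1).
Local Notation phi := (normal_pdf (0 : R) 1).

Lemma normal_pdf_le1 (x : R) : phi x <= 1.
Proof.
apply: le_trans (normal_pdf_ub _ _ (oner_neq0 _)) _.
rewrite /normal_peak expr1n mul1r invf_le1; last first.
  by rewrite sqrtr_gt0 pmulrn_rgt0 ?pi_gt0.
rewrite -[leLHS]sqrtr1 ler_wsqrtr// mulr2n.
by have := @pi_ge2 R; lra.
Qed.

Lemma lebesgue_itvcc (a b : R) : a <= b -> mu `[a, b] = (b - a)%:E.
Proof.
move=> ab; rewrite lebesgue_measure_itv/= lte_fin; case: ltP => // ba.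
by rewrite (_ : a = b) ?subrr//; apply/eqP; rewrite eq_le ab.
Qed.

Lemma normal_itv_le (a b : R) : a <= b -> (N `[a, b] <= (b - a)%:E)%E.
Proof.
move=> ab; rewrite /normal_prob.
apply: (@le_trans _ _ (\int[mu]_(x in `[a, b]) (cst 1 x))%E).
  apply: ge0_le_integral => //.
  - by move=> x _; rewrite lee_fin normal_pdf_ge0.
  - by apply: measurable_funTS; apply/measurable_EFinP; exact: measurable_normal_pdf.
  - by move=> x _; rewrite lee_fin normal_pdf_le1.
by rewrite integral_cst// mul1e -lebesgue_itvcc.
Qed.

Lemma normal_itv_ge (L a b : R) : a <= b -> - L <= a -> b <= L ->
  ((phi L * (b - a))%:E <= N `[a, b])%E.
Proof.
move=> ab La bL; rewrite /normal_prob.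
apply: (@le_trans _ _ (\int[mu]_(x in `[a, b]) (cst (phi L)%:E x))%E).
  by rewrite integral_cst// EFinM -lebesgue_itvcc.
apply: ge0_le_integral => //.
- by move=> x _; rewrite lee_fin normal_pdf_ge0.
- by apply: measurable_funTS; apply/measurable_EFinP; exact: measurable_normal_pdf.
- move=> x /=; rewrite in_itv/= => /andP[ax xb]; rewrite lee_fin !normal_pdf01E.
  rewrite ler_wpM2l ?invr_ge0 ?sqrtr_ge0// ler_expR ler_pM2r// lerN2.
  by rewrite -[leLHS]real_normK ?num_real// lerXn2r ?nnegrE ?normr_ge0 ?ler_norml//; lra.
Qed.

(** The integral is sqrt 2; the bound 2 serves both the polynomial tail below and
    the second moments of the sample. *)
Lemma normal_expR_sqr : (\int[N]_x (expR (x ^+ 2 / 4))%:E <= 2%:E)%E.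
Proof.
have m1 : measurable_fun setT (fun x : R => (expR (x ^+ 2 / 4))%:E).
  apply/measurable_EFinP; apply: measurableT_comp => //.
  by apply: measurable_funM => //; exact: measurable_funX.
rewrite normal_integral//.
have s2 : Num.sqrt (2 : R) != 0 by rewrite gt_eqF// sqrtr_gt0.
under eq_integral => x _.
  have -> : ((expR (x ^+ 2 / 4))%:E * (phi x)%:E =
     (Num.sqrt 2)%:E * (normal_pdf 0 (Num.sqrt 2) x)%:E)%E.
    rewrite -!EFinM; congr _%:E.
    rewrite normal_pdf01E normal_pdfE// /normal_peak /normal_fun subr0.
    rewrite sqr_sqrtr// -mulrnAr sqrtrM// invfM.
    rewrite mulrCA -expRD [in RHS]mulrA mulVKf//.
    by congr (_ * expR _); rewrite -mulr_natr; field.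
  over.
rewrite ge0_integralZl_EFin//.
- rewrite integral_normal_pdf mule1 lee_fin -[leRHS]ger0_norm// -sqrtr_sqr.
  by rewrite ler_wsqrtr//; lra.
- by move=> x _; rewrite lee_fin normal_pdf_ge0.
- by apply/measurable_EFinP; exact: measurable_normal_pdf.
Qed.

Lemma measurable_norm_ge (h : R) : measurable [set t : measurableTypeR R | h <= `|t|].
Proof.
rewrite -[X in measurable X]setTI.
by apply: measurable_fun_le => //; exact: measurableT_comp.
Qed.

Lemma normal_tail (h : R) : 0 < h ->
  (N [set t | (h <= `|t|)%R] <= (8 / h ^+ 2)%R%:E)%E.
Proof.
move=> h0.
have m1 : measurable_fun setT (fun x : R => (expR (x ^+ 2 / 4))%:E).
  apply/measurable_EFinP; apply: measurableT_comp => //.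
  by apply: measurable_funM => //; exact: measurable_funX.
have mh := measurable_norm_ge h.
have := normal_expR_sqr => H.
have h2 : 0 < h ^+ 2 by rewrite exprn_gt0.
have : ((h ^+ 2 / 4)%:E * N [set t | (h <= `|t|)%R] <= 2%:E)%E.
  apply: le_trans H.
  rewrite -[X in (_ * N X)%E]setIT -integral_indic// -ge0_integralZl_EFin//; last 2 first.
  - by apply/measurable_EFinP; exact: measurable_indic.
  - by rewrite divr_ge0// ltW.
  apply: ge0_le_integral => //.
  - by move=> x _; rewrite -EFinM lee_fin mulr_ge0// divr_ge0// ltW.
  - by apply: emeasurable_funM => //; apply/measurable_EFinP; exact: measurable_indic.
  - move=> x _; rewrite -EFinM lee_fin indicE.
    have [|_] := boolP (x \in _); last by rewrite mulr0 expR_ge0.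
    rewrite inE /= mulr1 => hx; apply: le_trans (expR_ge1Dx _).
    have : h ^+ 2 <= x ^+ 2 by rewrite -[leRHS]real_normK ?num_real// lerXn2r ?nnegrE ?normr_ge0// ltW.
    lra.
rewrite muleC -lee_pdivlMr ?divr_gt0// => /le_trans; apply.
rewrite -EFinM lee_fin le_eqVlt; apply/orP; left; apply/eqP; field.
by rewrite gt_eqF.
Qed.

Lemma fin_normal (B : set (measurableTypeR R)) : measurable B -> (fine (N B))%:E = N B.
Proof. by move=> mB; rewrite fineK// fin_num_measure. Qed.

Lemma Phi_diff (a b : R) : a <= b -> (N `]a, b] = (Phi b - Phi a)%:E)%E.
Proof.
move=> ab; rewrite /Phi EFinB !fin_normal//.
have -> : `]-oo, b]%classic = `]-oo, a]%classic `|` `]a, b]%classic :> set (measurableTypeR R).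
  by rewrite -itv_bndbnd_setU.
rewrite (measureU N)//.
  rewrite addeAC subee ?add0e//.
    exact: (fin_num_measure N _ (measurable_itv _)).
by apply/seteqP; split=> // x [] /=; rewrite !in_itv/= => ?; rewrite andbC; lra.
Qed.

Lemma normal_itvoc (a b : R) : a <= b -> N `[a, b] = N `]a, b].
Proof.
move=> ab; rewrite /normal_prob integral_itv_obnd_cbnd//.
by apply: measurable_funTS; apply/measurable_EFinP; exact: measurable_normal_pdf.
Qed.

Lemma Phi_lip (a b : R) : a <= b -> 0 <= Phi b - Phi a <= b - a.
Proof.
move=> ab; rewrite -!lee_fin -Phi_diff// measure_ge0/= -normal_itvoc//.
exact: normal_itv_le.
Qed.

(** On [-L, L] the density is at least its value at L. *)
Lemma Phi_ge (L a b : R) : a <= b -> - L <= a -> b <= L ->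
  phi L * (b - a) <= Phi b - Phi a.
Proof.
by move=> ab La bL; rewrite -lee_fin -Phi_diff// -normal_itvoc//; exact: normal_itv_ge.
Qed.

Lemma Phi_gt (a b : R) : a < b -> Phi a < Phi b.
Proof.
move=> ab; rewrite -subr_gt0.
apply: lt_le_trans (@Phi_ge (`|a| + `|b|) a b (ltW ab) _ _).
- rewrite mulr_gt0 ?subr_gt0// normal_pdf01E mulr_gt0 ?expR_gt0// invr_gt0.
  by rewrite sqrtr_gt0 pmulrn_rgt0 ?pi_gt0.
- have := ler_norm (- a); rewrite normrN; have := normr_ge0 b; lra.
- have := ler_norm b; have := normr_ge0 a; lra.
Qed.

Lemma normal_itvcy (t : R) : N `[t, +oo[ = (1 - Phi t)%:E.
Proof.
have -> : `[t, +oo[%classic = ~` `]-oo, t[%classic :> set (measurableTypeR R).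
  by rewrite setCitvl.
rewrite (probability_setC N)// EFinB /Phi fin_normal//; congr (_ - _)%E.
apply: integral_itv_bndo_bndc; apply: measurable_funTS;
  apply/measurable_EFinP; exact: measurable_normal_pdf.
Qed.

Lemma PhiN (t : R) : Phi (- t) = 1 - Phi t.
Proof.
apply: EFin_inj; rewrite -normal_itvcy /Phi fin_normal// -[LHS]normal_sym//.
by congr (N _); apply/seteqP; split=> x /=; rewrite !in_itv/= andbT lerN2.
Qed.

Lemma Phi0 : Phi (0 : R) = 2^-1.
Proof. by have := PhiN 0; rewrite oppr0; lra. Qed.

Lemma Phi_tail (t : R) : 0 < t -> 1 - Phi t <= 8 / t ^+ 2.
Proof.
move=> t0; rewrite -lee_fin -normal_itvcy; apply: le_trans (normal_tail t0).
apply: le_measure; rewrite ?inE//; first exact: measurable_norm_ge.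
by move=> x /=; rewrite in_itv/= andbT => /le_trans; apply; exact: ler_norm.
Qed.

Lemma Phi_continuous : continuous (@Phi R).
Proof.
move=> x; apply/cvgrPdist_lt => e e0; near=> y.
have xy : `|x - y| < e by near: y; apply/nbhs_ballP; exists e.
apply: le_lt_trans xy; have [h|/ltW h] := leP x y.
- have /andP[h1 h2] := Phi_lip h; rewrite distrC [leRHS]distrC.
  by rewrite !ger0_norm// subr_ge0.
- have := Phi_lip h => /andP[h1 h2].
  by rewrite !ger0_norm// subr_ge0.
Unshelve. all: end_near. Qed.

Lemma Phi_surj (y : R) : 2^-1 <= y < 1 -> exists2 t, 0 <= t & Phi t = y.
Proof.
move=> /andP[y0 y1].
pose T := 8 / (1 - y) + 1.
have u0 : 0 < 1 - y by lra.
have k0 : 0 <= 8 / (1 - y) by rewrite divr_ge0// ltW.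
have T1 : 1 <= T by rewrite /T; lra.
have T0 : 0 < T by lra.
have PT : y <= Phi T.
  have := Phi_tail T0.
  have : 8 / T ^+ 2 <= 1 - y.
    rewrite ler_pdivrMr ?exprn_gt0// mulrC -ler_pdivrMr// expr2.
    by apply: (@le_trans _ _ T); [rewrite /T; lra | nra].
  lra.
have [|t tT tE] := @IVT R Phi 0 T y (ltW T0) (continuous_subspaceT Phi_continuous).
  by rewrite Phi0; apply/andP; split; rewrite ?ge_min ?le_max ?y0 ?PT ?orbT.
by exists t => //; move: tT; rewrite in_itv/= => /andP[].
Qed.

(** The range of Phi is covered on [1/2, 1), where the argument of Phi_inv lies
    exactly when 0 <= eps < 1/3. *)
Lemma B_L_spec (eps : R) : 0 <= eps < 3^-1 ->
  0 <= B_L eps /\ Phi (B_L eps) = (1 + eps) / (2 * (1 - eps)).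
Proof.
move=> /andP[e0 e1]; set y := (1 + eps) / _.
have d0 : 0 < 2 * (1 - eps) by lra.
have hy : 2^-1 <= y < 1.
  by rewrite /y ler_pdivlMr// ltr_pdivrMr//; apply/andP; split; lra.
have PB : Phi (B_L eps) = y.
  rewrite /B_L /Phi_inv pinvK// inE/=.
  by have [t _ tE] := Phi_surj hy; exists t.
split=> //; rewrite leNgt; apply/negP => /Phi_gt.
by rewrite Phi0 PB; case/andP: hy; lra.
Qed.

Lemma Phi_le_inv (a b : R) : Phi a <= Phi b -> a <= b.
Proof. by move=> h; rewrite leNgt; apply/negP => /Phi_gt; lra. Qed.

Lemma B_L_le (eps eps' : R) : 0 <= eps <= eps' -> eps' < 3^-1 ->
  B_L eps <= B_L eps'.
Proof.
move=> /andP[e0 ee'] e1; apply: Phi_le_inv.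
have [|_ ->] := @B_L_spec eps; first by lra.
have [|_ ->] := @B_L_spec eps'; first by lra.
rewrite ler_pdivrMr; last lra.
rewrite mulrAC ler_pdivlMr; last lra.
nra.
Qed.

End gaussian_bounds.

(** * Nets of the unit sphere *)

Section nets.
Context {R : realType}.

Lemma geometric_sum_le (q : R) n : 0 <= q < 1 -> \sum_(k < n) q ^+ k <= (1 - q)^-1.
Proof.
move=> /andP[q0 q1]; have d0 : 0 < 1 - q by lra.
rewrite -[leRHS]mul1r ler_pdivlMr// mulrC.
have -> : (1 - q) * \sum_(k < n) q ^+ k = 1 - q ^+ n.
  by rewrite -[in RHS](expr1n R n) subrXX; congr (_ * _); apply: eq_bigr => i _;
     rewrite expr1n mul1r.
by rewrite gerBl exprn_ge0.
Qed.

(** Each admissible f is counted with weight q ^ (sum f - m p) >= 1, where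
    q = m / (m + 1); without the constraint the sum of the weights factors over
    the coordinates into geometric series.  The bound is (C m)^p with C
    absolute, because the constraint bears on the l1 norm. *)
Lemma card_bounded_sum p m L : (0 < m)%N ->
  #|[set f : {ffun 'I_p -> bool * 'I_L} | (\sum_i (f i).2 <= m * p)%N]%SET|%:R
    <= expR (p%:R * (1 + ln (4 * m%:R))) :> R.
Proof.
move=> m0; set S := [set _ | _]%SET.
have mR : 0 < m%:R :> R by rewrite ltr0n.
have m1 : 1 <= m%:R :> R by rewrite ler1n.
pose q : R := m%:R / (m%:R + 1).
have m10 : 0 < m%:R + 1 :> R by rewrite addr_gt0.
have q0 : 0 < q by rewrite divr_gt0.
have q1 : q < 1 by rewrite ltr_pdivrMr// mul1r ltrDl.
have -> : #|S|%:R = \sum_(f in S) 1 :> R by rewrite sumr_const.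
apply: (@le_trans _ _ (\sum_(f : {ffun 'I_p -> bool * 'I_L})
   q ^- (m * p) * \prod_i q ^+ (f i).2)).
  rewrite [leRHS](bigID (mem S))/=; apply: ler_wpDr.
    apply: sumr_ge0 => f _; rewrite mulr_ge0 ?invr_ge0 ?exprn_ge0 ?(ltW q0)//.
    by apply: prodr_ge0 => i _; rewrite exprn_ge0 ?(ltW q0).
  apply: ler_sum => f; rewrite inE => hf.
  rewrite -expr_sum -[leLHS](@mulVf _ (q ^+ (m * p))); last by rewrite gt_eqF// exprn_gt0.
  rewrite ler_wpM2l ?invr_ge0 ?exprn_ge0 ?(ltW q0)//.
  by apply: ler_wiXn2l => //; apply: ltW.
rewrite -mulr_sumr -(bigA_distr_bigA (fun _ (bk : bool * 'I_L) => q ^+ bk.2)) /=.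
rewrite prodr_const card_ord exprM -exprVn -exprMn.
rewrite expRM_natl; apply: lerXn2r; rewrite ?nnegrE.
- rewrite mulr_ge0 ?invr_ge0 ?exprn_ge0 ?(ltW q0)//.
  by apply: sumr_ge0 => i _; rewrite exprn_ge0 ?(ltW q0).
- exact: expR_ge0.
rewrite expRD lnK ?posrE ?mulr_gt0//.
have -> : \sum_(bk : bool * 'I_L) q ^+ bk.2 = 2 * \sum_(k < L) q ^+ k.
  rewrite -(pair_big xpredT xpredT (fun (b : bool) (k : 'I_L) => q ^+ k))/=.
  by rewrite big_bool/= mulr_natl mulr2n.
apply: ler_pM.
- by rewrite invr_ge0 exprn_ge0// ltW.
- by rewrite mulr_ge0// sumr_ge0// => i _; rewrite exprn_ge0// ltW.
- rewrite -exprVn invf_div mulrDl divff ?gt_eqF// div1r.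
  apply: (@le_trans _ _ (expR m%:R^-1 ^+ m)).
    by apply: lerXn2r; rewrite ?nnegrE ?expR_ge0 ?addr_ge0 ?invr_ge0 ?(ltW mR)//; exact: expR_ge1Dx.
  by rewrite -expRM_natl mulfV ?gt_eqF.
- have h := @geometric_sum_le q L; rewrite (ltW q0) q1 in h.
  apply: (@le_trans _ _ (2 * (1 - q)^-1)); first by rewrite ler_wpM2l// h.
  have -> : 1 - q = (m%:R + 1)^-1 by rewrite /q; field; rewrite gt_eqF.
  by rewrite invrK; lra.
Qed.

(** Round the coordinates of v towards 0 on the grid of mesh 1 / (m sqrt p).  The
    error is at most 1 / m in norm, and since |v|_1 <= sqrt p the integer vector
    obtained has l1 norm at most m p, so [card_bounded_sum] counts the grid
    points. *)
Lemma sphere_net p m : (0 < p)%N -> (0 < m)%N ->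
  exists s : seq (space R p),
    (size s)%:R <= expR (p%:R * (1 + ln (4 * m%:R))) :> R /\
    forall v : space R p, norm2 v = 1 ->
      exists2 w, w \in s & norm2 (vsub v w) <= m%:R^-1.
Proof.
move=> p0 m0.
have mR : 0 < m%:R :> R by rewrite ltr0n.
have pR : 0 < p%:R :> R by rewrite ltr0n.
set L := (m * p).+1.
pose S := [set f : {ffun 'I_p -> bool * 'I_L} | (\sum_i (f i).2 <= m * p)%N]%SET.
pose rp := Num.sqrt (p%:R : R).
have rp0 : 0 < rp by rewrite sqrtr_gt0.
have rp2 : rp ^+ 2 = p%:R by rewrite sqr_sqrtr// ltW.
pose a := m%:R * rp.
have a0 : 0 < a by rewrite mulr_gt0.
pose pt (f : {ffun 'I_p -> bool * 'I_L}) : space R p :=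
  [tuple (-1) ^+ (f i).1 * ((f i).2%:R / a) | i < p].
exists (map pt (enum S)); split.
  by rewrite size_map -cardE; exact: card_bounded_sum.
move=> v v1.
have v2 : \sum_i (tnth v i) ^+ 2 = 1.
  rewrite -[RHS](expr1n _ 2) -v1 /norm2 sqr_sqrtr /dotp.
    by apply: eq_bigr => i _; rewrite expr2.
  by apply: sumr_ge0 => i _; rewrite -expr2 sqr_ge0.
pose k i := Num.truncn (`|tnth v i| * a).
have x0 i : 0 <= `|tnth v i| * a by rewrite mulr_ge0// ltW.
have kle i : (k i)%:R <= `|tnth v i| * a by rewrite truncn_le.
have klt i : `|tnth v i| * a <= (k i)%:R + 1.
  by rewrite natr1 ltW// truncnS_gt.
have sk : (\sum_i k i <= m * p)%N.
  rewrite -(ler_nat R) natr_sum natrM.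
  apply: (@le_trans _ _ (\sum_i m%:R * ((p%:R * tnth v i ^+ 2 + 1) / 2))).
    apply: ler_sum => i _; apply: le_trans (kle i) _.
    rewrite /a mulrCA ler_wpM2l ?(ltW mR)// -rp2.
    have := sqr_ge0 (rp * `|tnth v i| - 1).
    by rewrite -[tnth v i ^+ 2]real_normK ?num_real//; nra.
  rewrite -mulr_sumr -mulr_suml big_split/= -mulr_sumr v2 sumr_const card_ord.
  by rewrite ler_wpM2l ?(ltW mR)//; lra.
have kL i : (k i < L)%N.
  by rewrite ltnS (leq_trans _ sk)// (bigD1 i)//= leq_addr.
pose f : {ffun 'I_p -> bool * 'I_L} := [ffun i => (tnth v i < 0, Ordinal (kL i))].
exists (pt f).
  apply: map_f; rewrite mem_enum inE.
  by under eq_bigr do rewrite ffunE /=.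
have d i : (tnth v i - tnth (pt f) i) ^+ 2 <= (a ^+ 2)^-1.
  rewrite tnth_mktuple ffunE /=.
  have -> : tnth v i - (-1) ^+ (tnth v i < 0)%R * ((k i)%:R / a) =
     (-1) ^+ (tnth v i < 0)%R * ((`|tnth v i| * a - (k i)%:R) / a).
    rewrite {1}[tnth v i]realEsign ?num_real//; field; by rewrite gt_eqF.
  rewrite exprMn sqrr_sign mul1r expr_div_n ler_pdivrMr ?exprn_gt0// mulVf; last first.
    by rewrite gt_eqF// exprn_gt0.
  by have := kle i; have := klt i; nra.
rewrite -[leRHS]ger0_norm ?invr_ge0 ?(ltW mR)// -sqrtr_sqr ler_wsqrtr//.
apply: (@le_trans _ _ (\sum_(i < p) (a ^+ 2)^-1)).
  apply: ler_sum => i _; rewrite tnth_mktuple -expr2; exact: d.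
rewrite sumr_const card_ord -[leLHS]mulr_natr /a exprMn rp2 exprVn.
by rewrite invfM -mulrA mulVf ?mulr1// gt_eqF.
Qed.

End nets.

(** * Uniform deviations over halfspace-spaces by chaining *)

Lemma expR1_ge2 (R : realType) : 2 <= expR 1 :> R.
Proof. by apply: le_trans (expR_ge1Dx _); lra. Qed.

Lemma expRN4_le (R : realType) k : expR (- (4 * k%:R)) <= 16%:R ^- k :> R.
Proof.
rewrite mulrC -mulrN expRM_natl -exprVn lerXn2r ?nnegrE ?expR_ge0 ?invr_ge0//.
rewrite expRN lef_pV2 ?posrE ?expR_gt0//.
have -> : expR 4 = expR 1 ^+ 4 :> R by rewrite -expRM_natl mulr1.
have -> : 16%:R = 2 ^+ 4 :> R by rewrite -natrX.
by rewrite lerXn2r ?nnegrE ?expR_ge0// expR1_ge2.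
Qed.

Lemma sphere_nets (R : realType) p : (0 < p)%N ->
  exists (s : nat -> seq (space R p)) (pr : nat -> space R p -> space R p),
    forall k, (size (s k))%:R <= expR (4 * k.+1%:R * p%:R) :> R /\
      forall v, norm2 v = 1 -> pr k v \in s k /\
        norm2 (vsub v (pr k v)) <= 2^-1 * 2 ^- k ^+ 3.
Proof.
move=> p0.
suff h k : exists spr : seq (space R p) * (space R p -> space R p),
    (size spr.1)%:R <= expR (4 * k.+1%:R * p%:R) :> R /\
      forall v, norm2 v = 1 -> spr.2 v \in spr.1 /\
        norm2 (vsub v (spr.2 v)) <= 2^-1 * 2 ^- k ^+ 3.
  have [f hf] := choice h; exists (fun k => (f k).1), (fun k => (f k).2).
  exact: hf.
have m0 : (0 < 2 * 8 ^ k)%N by rewrite muln_gt0 expn_gt0.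
have [s [ss hs]] := @sphere_net R p _ p0 m0.
have /choice[f hf] : forall v : space R p, exists w, norm2 v = 1 ->
    w \in s /\ norm2 (vsub v w) <= 2^-1 * 2 ^- k ^+ 3.
  move=> v; have [v1|v1] := pselect (norm2 v = 1); last by exists v.
  have [w ws vw] := hs v v1; exists w => _; split=> //.
  apply: le_trans vw _; rewrite natrM invfM natrX.
  have -> : 8%:R = 2 ^+ 3 :> R by rewrite -natrX.
  by rewrite -exprM mulnC exprM exprVn mulrC.
exists (s, f); split=> //=.
apply: le_trans ss _; rewrite ler_expR [leRHS]mulrC ler_wpM2l//.
have -> : 4 * (2 * 8 ^ k)%:R = (2 ^+ 3) ^+ k.+1 :> R.
  have e8 : 8%:R = 2 ^+ 3 :> R by rewrite -natrX.
  by rewrite natrM natrX e8 [RHS]exprS; move: (_ ^+ k) => y; ring.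
rewrite -exprM lnXn//.
have l2 : ln (2 : R) <= 1.
  by rewrite -[leRHS](@expRK R) ler_ln ?posrE ?expR_gt0// expR1_ge2.
rewrite -[ln 2 *+ _]mulr_natr natrM -[k.+1]addn1 natrD.
have k0 : 0 <= k%:R :> R by [].
by nra.
Qed.

Lemma sum_geo (R : realType) j : \sum_(k < j) (2 ^- k : R) <= 2.
Proof.
have -> : \sum_(k < j) (2 ^- k : R) = 2 - 2 * 2 ^- j.
  elim: j => [|j IH]; first by rewrite big_ord0 expr0 invr1; lra.
  by rewrite big_ord_recr /= IH exprS invfM; lra.
by rewrite gerBl mulr_ge0// invr_ge0 exprn_ge0.
Qed.

Lemma sum_arith_geo (R : realType) j : \sum_(k < j) (k.+1%:R * 2 ^- k : R) <= 4.
Proof.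
have -> : \sum_(k < j) (k.+1%:R * 2 ^- k : R) = 4 - (2 * j%:R + 4) * 2 ^- j.
  elim: j => [|j IH]; first by rewrite big_ord0 expr0 invr1; lra.
  rewrite big_ord_recr /= IH exprS invfM -[j.+1]addn1 natrD.
  by move: (2 ^- j) => y; lra.
by rewrite gerBl mulr_ge0 ?invr_ge0 ?exprn_ge0// addr_ge0// mulr_ge0.
Qed.

Lemma sum_geo16 (R : realType) j : \sum_(k < j) (16%:R ^- k.+1 : R) <= 15^-1.
Proof.
have -> : \sum_(k < j) (16%:R ^- k.+1 : R) = 15^-1 - 15^-1 * 16 ^- j.
  elim: j => [|j IH]; first by rewrite big_ord0 expr0 invr1; lra.
  rewrite big_ord_recr /= IH exprS invfM; move: (16 ^- j) => y; lra.
by rewrite gerBl mulr_ge0 ?invr_ge0 ?exprn_ge0.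
Qed.

Section chaining.
Context {d : measure_display} {T : measurableType d} {R : realType}.
(* Q is the law of one labelled observation: Gd is the event that it is genuine
   and Z its Gaussian part, which is standard normal and independent of Gd. *)
Variables (Q : probability T R) (Gd : set T) (p : nat) (Z : T -> space R p) (e : R).
Local Notation N := (normal_prob (0 : R) 1).
Hypotheses (mGd : measurable Gd) (mZ : measurable_fun setT Z).
Hypothesis QZ : forall w (B : set (measurableTypeR R)), measurable B ->
  Q [set t | B (dotp w (Z t))] = N [set r | B (norm2 w * r)].
Hypothesis QGZ : forall w (B : set (measurableTypeR R)), measurable B ->
  Q [set t | Gd t /\ B (dotp w (Z t))] =
  ((1 - e)%:E * N [set r | B (norm2 w * r)%R])%E.
Hypothesis e01 : 0 <= e <= 1.

Definition halfspace (w : space R p) (s : R) : set T :=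
  [set t | Gd t /\ s <= dotp w (Z t)].

Definition slab (u : space R p) (h : R) : set T :=
  [set t | h <= `|dotp u (Z t)|].

Definition window (w : space R p) (s h : R) : set T :=
  [set t | `[(s - h), (s + h)]%classic (dotp w (Z t))].

Lemma measurable_dotpZ w : measurable_fun setT (fun t => dotp w (Z t) : measurableTypeR R).
Proof. by apply: measurableT_comp => //; exact: measurable_dotp. Qed.

Lemma measurable_halfspace w s : measurable (halfspace w s).
Proof.
rewrite /halfspace (_ : [set _ | _] = Gd `&` [set t | s <= dotp w (Z t)])//.
apply: measurableI => //; rewrite -[X in measurable X]setTI.
by apply: measurable_fun_le => //; exact: measurable_dotpZ.
Qed.

Lemma measurable_slab u h : measurable (slab u h).
Proof.
rewrite -[X in measurable X]setTI; apply: measurable_fun_le => //.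
by apply: measurableT_comp => //; exact: measurable_dotpZ.
Qed.

Definition halfspace_prob w s := fine (Q (halfspace w s)).

Lemma halfspace_probE w s : Q (halfspace w s) = (halfspace_prob w s)%:E.
Proof. by rewrite /halfspace_prob fineK// fin_num_measure//; exact: measurable_halfspace. Qed.

Lemma slab_le (u : space R p) (h r : R) : 0 < h -> norm2 u <= r ->
  (Q (slab u h) <= (8 * r ^+ 2 / h ^+ 2)%:E)%E.
Proof.
move=> h0 ur; rewrite /slab (QZ u (measurable_norm_ge h)).
have := norm2_ge0 u; rewrite le_eqVlt => /orP[/eqP u0|u0].
  rewrite (_ : [set _ | _] = set0) ?measure0 ?lee_fin.
    by apply: divr_ge0; [apply: mulr_ge0 => //; exact: sqr_ge0|exact: sqr_ge0].
  by apply/seteqP; split=> // t /=; rewrite -u0 mul0r normr0 leNgt h0.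
rewrite (_ : [set _ | _] = [set t | h / norm2 u <= `|t|]); last first.
  apply/seteqP; split=> t /=; by rewrite normrM (gtr0_norm u0) ler_pdivrMr// [_ * norm2 u]mulrC.
apply: le_trans (normal_tail _) _; first by rewrite divr_gt0.
rewrite lee_fin expr_div_n invf_div mulrA ler_wpM2r ?invr_ge0 ?sqr_ge0//.
by rewrite ler_wpM2l// lerXn2r// nnegrE ?norm2_ge0// (le_trans _ ur)// norm2_ge0.
Qed.

Lemma window_le (w : space R p) (s h : R) : 0 <= h -> 2^-1 <= norm2 w ->
  (Q (window w s h) <= (4 * h)%:E)%E.
Proof.
move=> h0 w0; rewrite /window QZ//.
have w1 : 0 < norm2 w by lra.
rewrite (_ : [set _ | _] = `[(s - h) / norm2 w, (s + h) / norm2 w]%classic); last first.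
  by apply/seteqP; split=> t /=; rewrite !in_itv/= ler_pdivrMr// ler_pdivlMr// mulrC.
apply: le_trans (normal_itv_le _) _; first by rewrite ler_pM2r ?invr_gt0//; lra.
rewrite lee_fin -mulrBl ler_pdivrMr//; nra.
Qed.

(** If a point is on different sides for w and w', then w.Z is within h of the
    level or |(w - w').Z| >= h.  The choice of h balances the density bound for
    the first event against the tail bound for the second. *)
Lemma halfspace_diff (w w' : space R p) (s h r : R) : 0 < h -> 2^-1 <= norm2 w ->
  norm2 (vsub w w') <= r ->
  fine (Q (halfspace w s `\` halfspace w' s)) + fine (Q (halfspace w' s `\` halfspace w s))
    <= 4 * h + 8 * r ^+ 2 / h ^+ 2.
Proof.
move=> h0 w0 wr.
have m1 := measurable_halfspace w s; have m2 := measurable_halfspace w' s.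
have m12 := measurableD m1 m2; have m21 := measurableD m2 m1.
rewrite -lee_fin EFinD !fineK ?fin_num_measure// -measureU//; last first.
  by apply/seteqP; split=> // t [[? ?] []].
have mW : measurable (window w s h).
  by rewrite -[X in measurable X]setTI; exact: measurable_dotpZ.
have mS := measurable_slab (vsub w w') h.
apply: (@le_trans _ _ (Q (window w s h `|` slab (vsub w w') h))).
  apply: le_measure; rewrite ?inE; [exact: measurableU|exact: measurableU|].
  have aux a b t : s - h <= a <= s + h \/ h <= `|a - b| ->
    a = dotp w (Z t) -> b = dotp w' (Z t) ->
    (window w s h `|` slab (vsub w w') h) t.
    move=> H aE bE; rewrite aE bE in H; case: H => H; [left|right].
      by rewrite /window/= in_itv.
    by rewrite /slab/= dotp_vsubl.
  move=> t [[[Gt st] nt]|[[Gt st] nt]]; apply: (aux _ _ _ _ erefl erefl).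
  - have {}nt : dotp w' (Z t) < s by rewrite ltNge; apply/negP => ?; apply: nt.
    have [c|c] := lerP (dotp w (Z t)) (s + h); [left; lra|right].
    by apply: le_trans (ler_norm _); lra.
  - have {}nt : dotp w (Z t) < s by rewrite ltNge; apply/negP => ?; apply: nt.
    have [c|c] := lerP (s - h) (dotp w (Z t)); [left; lra|right].
    by rewrite distrC; apply: le_trans (ler_norm _); lra.
apply: le_trans (measureU2 _ mW mS) _.
by rewrite EFinD; apply: leeD; [exact: window_le (ltW h0) w0|exact: slab_le].
Qed.

Lemma hoeffding_event (U : set T) n (h : R) : measurable U -> 0 <= h <= 2^-1 ->
  (iid_law Q n [set x | (n%:R * (fine (Q U) + 10 * h) <= cnt U x)%R] <=
   (expR (- (8 * (n%:R * h ^+ 2))))%:E)%E.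
Proof.
move=> mU h01.
have := @bernstein_diff _ _ _ Q U set0 n h (10 * h) mU measurable0 (setI0 _) h01.
rewrite measure0 /= subr0 addr0.
have -> : [set x : n.-tuple T | n%:R * (fine (Q U) + 10 * h) <= cnt U x - cnt set0 x] =
          [set x | n%:R * (fine (Q U) + 10 * h) <= cnt U x].
  apply/seteqP; split=> x /=; rewrite [cnt set0 x]big1 ?subr0// => i _;
  by rewrite indicE in_set0.
move=> /le_trans; apply; rewrite lee_fin ler_expR lerN2.
have : fine (Q U) <= 1 by rewrite -lee_fin fineK ?fin_num_measure ?probability_le1.
have n0 : 0 <= n%:R * h ^+ 2 by rewrite mulr_ge0 ?sqr_ge0.
move=> u1; have := ler_wpM2l n0 u1; lra.
Qed.

(** Here a = 2^-k is the level of the chain.  The window width a^2 makes both terms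
    of [halfspace_diff] of order a^2, for a variance of at most 12 a^2; the
    Chernoff parameter is h / a. *)
Lemma increment_event (w w' : space R p) (s h a m : R) n : 0 < a -> 0 < h -> h <= a / 2 ->
  2^-1 <= norm2 w -> norm2 (vsub w w') <= a ^+ 3 ->
  (iid_law Q n [set x | (n%:R * (halfspace_prob w s - halfspace_prob w' s + (24 + m) * h * a) <=
      cnt (halfspace w s) x - cnt (halfspace w' s) x)%R] <=
   (expR (- (m * (n%:R * h ^+ 2))))%:E)%E.
Proof.
move=> a0 h0 ha w0 ww'.
have m1 := measurable_halfspace w s; have m2 := measurable_halfspace w' s.
have m12 := measurableD m1 m2; have m21 := measurableD m2 m1.
have th01 : 0 <= h / a <= 2^-1.
  by rewrite divr_ge0 ?(ltW a0) ?(ltW h0)//= ler_pdivrMr//; lra.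
have disj : (halfspace w s `\` halfspace w' s) `&` (halfspace w' s `\` halfspace w s) = set0.
  by apply/seteqP; split=> // t [[? ?] []].
have := bernstein_diff Q n ((24 + m) * h * a) m12 m21 disj th01.
rewrite fine_diff// -/(halfspace_prob w s) -/(halfspace_prob w' s).
have -> : [set x : n.-tuple T | n%:R * (halfspace_prob w s - halfspace_prob w' s + (24 + m) * h * a) <=
     cnt (halfspace w s `\` halfspace w' s) x - cnt (halfspace w' s `\` halfspace w s) x] =
   [set x | n%:R * (halfspace_prob w s - halfspace_prob w' s + (24 + m) * h * a) <=
     cnt (halfspace w s) x - cnt (halfspace w' s) x].
  by apply/seteqP; split=> x /=; rewrite cnt_diff.
move=> /le_trans; apply; rewrite lee_fin ler_expR lerN2.
have a20 : 0 < a ^+ 2 by rewrite exprn_gt0.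
have := halfspace_diff s a20 w0 ww'; set S := _ + _.
have -> : 4 * a ^+ 2 + 8 * a ^+ 3 ^+ 2 / a ^+ 2 ^+ 2 = 12 * a ^+ 2.
  by field; rewrite gt_eqF.
move=> hS.
rewrite mulrCA ler_wpM2l//.
have -> : h / a * ((24 + m) * h * a) = (24 + m) * h ^+ 2.
  by field; rewrite gt_eqF.
have : 2 * (h / a) ^+ 2 * S <= 24 * h ^+ 2.
  apply: (@le_trans _ _ (2 * (h / a) ^+ 2 * (12 * a ^+ 2))).
    by rewrite ler_wpM2l// mulr_ge0 ?sqr_ge0.
  by rewrite le_eqVlt; apply/orP; left; apply/eqP; field; rewrite gt_eqF.
by lra.
Qed.

(** The level k term of the sum controls the passage from pr k v to pr k.+1 v.  There
    are exp (O((k + 1) p)) pairs of net points at these levels, and the increment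
    of the count over a pair has variance O(4^-k) n, so a threshold
    O((k + 1) 2^-k) h n survives the union bound over the pairs.  These
    thresholds are summable in k, and so are the probabilities of failure. *)
Lemma chaining_bound (s : nat -> seq (space R p)) (pr : nat -> space R p -> space R p)
  (x c h : R) K n : 0 <= x -> (0 < p)%N -> 0 < h -> h <= 2 ^- K / 2 ->
  p%:R + x <= n%:R * h ^+ 2 ->
  (forall k, (size (s k))%:R <= expR (4 * k.+1%:R * p%:R) :> R /\
      forall v, norm2 v = 1 -> pr k v \in s k /\
        norm2 (vsub v (pr k v)) <= 2^-1 * 2 ^- k ^+ 3) ->
  forall j, (j <= K.+1)%N -> exists B : set (n.-tuple T), [/\ measurable B,
    (iid_law Q n B <= (expR (- x) * (16^-1 + \sum_(k < j) 16%:R ^- k.+1))%:E)%E &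
    forall y, ~ B y -> forall v, norm2 v = 1 ->
      cnt (halfspace (pr j v) c) y <= n%:R * (halfspace_prob (pr j v) c + 10 * h +
         \sum_(k < j) (24 + 16 * k.+1%:R) * h * 2 ^- k)].
Proof.
move=> x0 p0 h0 hK hn hs.
have pR : 1 <= p%:R :> R by rewrite ler1n.
have n0 : 0 <= n%:R :> R by [].
have K1 : 2 ^- K <= 1 :> R by rewrite -exprVn exprn_ile1// ?invr_ge0// invf_le1// ler1n.
elim=> [_|j IH jK].
  have [|B [mB PB EB]] := @union_bound _ _ _ (iid_law Q n) _ (s 0%N) (fun w => 2^-1 <= norm2 w)
    (fun w => [set y : n.-tuple T | n%:R * (fine (Q (halfspace w c)) + 10 * h) <= cnt (halfspace w c) y])
    _ (expR_ge0 (- (8 * (n%:R * h ^+ 2)))).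
    move=> w _ _; split; last first.
      apply: hoeffding_event; first exact: measurable_halfspace.
      by rewrite ltW//=; lra.
    rewrite -[X in measurable X]setTI; apply: measurable_fun_le => //.
    apply: measurable_cnt; exact: measurable_halfspace.
  exists B; split=> //.
    apply: le_trans PB _; rewrite lee_fin big_ord0 addr0.
    apply: (@le_trans _ _ (expR (4 * p%:R) * expR (- (8 * (n%:R * h ^+ 2))))).
      rewrite ler_wpM2r ?expR_ge0//; have [+ _] := hs 0%N.
      by rewrite mulr1.
    rewrite -expRD; apply: (@le_trans _ _ (expR (- x) * expR (- (4 * 1%:R)))).
      by rewrite -expRD ler_expR; lra.
    by rewrite ler_wpM2l ?expR_ge0// (le_trans (expRN4_le _ 1))// expr1.
  move=> y By v v1; rewrite big_ord0 addr0 leNgt; apply/negP => H; apply: By.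
  have [_ /(_ v v1) [vs vp]] := hs 0%N.
  apply: (EB _ vs _ _ (ltW H)).
  rewrite expr0 invr1 expr1n mulr1 in vp.
  by have /andP[] := norm2_near_unit v1 vp.
have {IH} [B0 [mB0 PB0 EB0]] := IH (ltnW jK).
pose a : R := 2 ^- j.
have a0 : 0 < a by rewrite invr_gt0 exprn_gt0.
have a1 : a <= 1 by rewrite /a -exprVn exprn_ile1// ?invr_ge0// invf_le1// ler1n.
have ha : h <= a / 2.
  apply: le_trans hK _; rewrite ler_pM2r// /a lef_pV2 ?posrE ?exprn_gt0//.
  by rewrite ler_eXn2l// ?ltr1n.
have [|B1 [mB1 PB1 EB1]] := @union_bound _ _ _ (iid_law Q n) _
    [seq (w, w') | w <- s j.+1, w' <- s j]
    (fun ww => (2^-1 <= norm2 ww.1) && (norm2 (vsub ww.1 ww.2) <= a ^+ 3))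
    (fun ww => [set y : n.-tuple T |
       n%:R * (halfspace_prob ww.1 c - halfspace_prob ww.2 c + (24 + 16 * j.+1%:R) * h * a) <=
       cnt (halfspace ww.1 c) y - cnt (halfspace ww.2 c) y])
    _ (expR_ge0 (- (16 * j.+1%:R * (n%:R * h ^+ 2)))).
  move=> [w w'] _ /= /andP[w0 ww']; split; last exact: increment_event.
  rewrite -[X in measurable X]setTI; apply: measurable_fun_le => //.
  by apply: measurable_funB; apply: measurable_cnt; exact: measurable_halfspace.
exists (B0 `|` B1); split; first exact: measurableU.
  apply: le_trans (measureU2 _ mB0 mB1) _.
  rewrite big_ord_recr /= addrA mulrDr EFinD; apply: leeD => //.
  apply: le_trans PB1 _; rewrite lee_fin size_allpairs natrM.
  have [h1 _] := hs j.+1; have [h2 _] := hs j.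
  apply: (@le_trans _ _ (expR (4 * j.+2%:R * p%:R) * expR (4 * j.+1%:R * p%:R) *
     expR (- (16 * j.+1%:R * (n%:R * h ^+ 2))))).
    by rewrite ler_wpM2r ?expR_ge0// ler_pM.
  apply: (@le_trans _ _ (expR (- x) * expR (- (4 * j.+1%:R)))); last first.
    by rewrite ler_wpM2l ?expR_ge0// expRN4_le.
  rewrite -!expRD ler_expR -[j.+2]addn2 -[j.+1]addn1 !natrD.
  have j0 : 0 <= j%:R :> R by [].
  (* The exponent to check is (8 j + 12) p - 16 (j + 1) n h^2 <= - x - 4 (j + 1). *)
  have h3 := ler_wpM2l (addr_ge0 j0 (ler01)) hn.
  have h4 : 0 <= (j%:R : R) * x by rewrite mulr_ge0.
  have h5 : 0 <= (j%:R : R) * (p%:R - 1) by rewrite mulr_ge0// subr_ge0.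
  lra.
move=> y nB v v1.
have nB0 : ~ B0 y by move=> ?; apply: nB; left.
have nB1 : ~ B1 y by move=> ?; apply: nB; right.
have H0 := EB0 y nB0 v v1.
have [_ /(_ v v1) [vs1 vp1]] := hs j.+1; have [_ /(_ v v1) [vs0 vp0]] := hs j.
have a3 : 0 <= a ^+ 3 by rewrite exprn_ge0// ltW.
have a31 : a ^+ 3 <= 1 by rewrite exprn_ile1// ltW.
have vp1' : norm2 (vsub v (pr j.+1 v)) <= 2^-1 * a ^+ 3.
  apply: le_trans vp1 _; rewrite ler_pM2l ?invr_gt0// lerXn2r ?nnegrE ?invr_ge0 ?exprn_ge0 ?(ltW a0)//.
  by rewrite /a lef_pV2 ?posrE ?exprn_gt0// ler_eXn2l// ltr1n.
have vp0' : norm2 (vsub v (pr j v)) <= 2^-1 * a ^+ 3 by [].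
rewrite big_ord_recr /= leNgt; apply/negP => H; apply: nB1.
apply: (EB1 (pr j.+1 v, pr j v)).
- exact: allpairs_f.
- apply/andP; split => /=.
    have : norm2 (vsub v (pr j.+1 v)) <= 2^-1 by lra.
    by case/(norm2_near_unit v1)/andP.
  by have := norm2_triangle (pr j.+1 v) (pr j v) v; rewrite (norm2_vsubC _ v); lra.
- move=> /=; set S := \sum_(k < j) _ in H H0; rewrite -/a in H.
  lra.
Qed.

Lemma integral_expR_dotp (w : space R p) : norm2 w <= 2 ->
  (\int[Q]_t (expR (dotp w (Z t) ^+ 2 / 16))%:E <= 2%:E)%E.
Proof.
move=> w2.
have mf : measurable_fun setT (fun r : measurableTypeR R => (expR (r ^+ 2 / 16))%:E).
  apply/measurable_EFinP; apply: measurableT_comp => //.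
  by apply: measurable_funM => //; exact: measurable_funX.
have mD := measurable_dotpZ w.
have mN : measurable_fun setT (fun r : measurableTypeR R => norm2 w * r : measurableTypeR R).
  exact: measurable_funM.
have -> : (\int[Q]_t (expR (dotp w (Z t) ^+ 2 / 16))%:E =
    \int[N]_r (expR ((norm2 w * r) ^+ 2 / 16))%:E)%E.
  rewrite -[LHS](@ge0_integral_pushforward _ _ _ _ _ _ mD Q setT (fun r => (expR (r ^+ 2 / 16))%:E))//.
  rewrite -[RHS](@ge0_integral_pushforward _ _ _ _ _ _ mN N setT (fun r => (expR (r ^+ 2 / 16))%:E))//.
  by apply: eq_measure_integral => A mA _; exact: QZ.
apply: le_trans normal_expR_sqr.
apply: ge0_le_integral => //.
- by apply: (measurableT_comp mf).
- apply/measurable_EFinP; apply: measurableT_comp => //.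
  by apply: measurable_funM => //; exact: measurable_funX.
- move=> r _; rewrite lee_fin ler_expR exprMn.
  have h : norm2 w ^+ 2 <= 4.
    by have -> : 4 = 2 ^+ 2 :> R by [ring]; rewrite lerXn2r ?nnegrE ?norm2_ge0.
  have := ler_wpM2r (sqr_ge0 r) h; lra.
Qed.

(** On a net of radius 1/2 the bound is a Chernoff bound.  Writing v = w + (v - w) with w in the net, the
    supremum over the sphere is at most twice the maximum over the net plus half
    of itself, and it is finite by Cauchy-Schwarz. *)
Lemma opnorm_event (x h : R) n : 0 <= x -> (0 < p)%N -> 0 < h <= 1 ->
  p%:R + x <= n%:R * h ^+ 2 ->
  exists B : set (n.-tuple T), [/\ measurable B,
    (iid_law Q n B <= (expR (- x) * 16^-1)%:E)%E &
    forall y, ~ B y -> forall u,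
      \sum_(i < n) dotp u (Z (tnth y i)) ^+ 2 <= 576 * n%:R * norm2 u ^+ 2].
Proof.
move=> x0 p0 /andP[h0 h1] hn.
have [s [pr hs]] := @sphere_nets R p p0.
have {hs} [ss hs] := hs 0%N.
have pR : 1 <= p%:R :> R by rewrite ler1n.
have n0 : 0 <= n%:R :> R by [].
pose g (w : space R p) (t : T) : R := dotp w (Z t) ^+ 2 / 16.
have mg w : measurable_fun setT (g w).
  apply: measurable_funM => //; apply: measurable_funX; exact: measurable_dotpZ.
have [|B [mB PB EB]] := @union_bound _ _ _ (iid_law Q n) _ (s 0%N) (fun w => norm2 w <= 2)
    (fun w => [set y : n.-tuple T | 9 * n%:R <= \sum_(i < n) g w (tnth y i)])
    _ (expR_ge0 (- (8 * n%:R))).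
  move=> w _ w2; split.
    rewrite -[X in measurable X]setTI; apply: measurable_fun_le => //.
    exact: measurable_sum_tnth.
  apply: le_trans (iid_law_chernoff n _ (mg w) (integral_expR_dotp w2)) _.
  rewrite lee_fin; apply: (@le_trans _ _ (expR (- (9 * n%:R)) * expR 1 ^+ n)).
    by rewrite ler_wpM2l ?expR_ge0// lerXn2r ?nnegrE ?expR_ge0// expR1_ge2.
  by rewrite -expRM_natl -expRD ler_expR; lra.
exists B; split=> //.
  apply: le_trans PB _; rewrite lee_fin.
  apply: (@le_trans _ _ (expR (4 * p%:R) * expR (- (8 * n%:R)))).
    by rewrite ler_wpM2r ?expR_ge0//; rewrite mulr1 in ss.
  apply: (@le_trans _ _ (expR (- x) * expR (- (4 * 1%:R)))); last first.
    by rewrite ler_wpM2l ?expR_ge0// (le_trans (expRN4_le _ 1))// expr1.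
  rewrite -!expRD ler_expR.
  have : n%:R * h ^+ 2 <= n%:R by rewrite ler_piMr// exprn_ile1// ltW.
  lra.
move=> y nB.
pose F (u : space R p) := \sum_(i < n) dotp u (Z (tnth y i)) ^+ 2.
have FZ c u : F (vscale c u) = c ^+ 2 * F u.
  by rewrite /F mulr_sumr; apply: eq_bigr => i _; rewrite dotp_vscalel exprMn.
pose A := [set F v | v in [set v : space R p | norm2 v = 1]].
have Aub : ubound A (\sum_(i < n) norm2 (Z (tnth y i)) ^+ 2).
  move=> _ [v v1 <-]; apply: ler_sum => i _.
  by apply: le_trans (dotp_sqr_le _ _) _; rewrite v1 expr1n mul1r.
have FS u : F u <= norm2 u ^+ 2 * sup A.
  have [u0|u0] := eqVneq (norm2 u) 0.
    rewrite u0 expr0n mul0r /F big1// => i _.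
    by rewrite norm2_eq0// expr0n.
  have {}u0 : 0 < norm2 u by rewrite lt_def u0 norm2_ge0.
  rewrite -ler_pdivrMl ?exprn_gt0// -exprVn -FZ.
  apply: ub_le_sup; first by exists (\sum_(i < n) norm2 (Z (tnth y i)) ^+ 2).
  by exists (vscale (norm2 u)^-1 u) => //; exact: norm2_normalize.
move=> u; rewrite -/(F u) mulrC; apply: le_trans (FS u) _.
have [u0|u0] := eqVneq (norm2 u) 0; first by rewrite u0 expr0n !mul0r.
rewrite ler_wpM2l ?sqr_ge0//.
suff : sup A <= 288 * n%:R + sup A / 2 by lra.
have {}u0 : 0 < norm2 u by rewrite lt_def u0 norm2_ge0.
apply: ge_sup.
  by exists (F (vscale (norm2 u)^-1 u)), (vscale (norm2 u)^-1 u) => //; exact: norm2_normalize.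
move=> _ [v v1 <-].
have [vs vp] := hs v v1.
rewrite expr0 invr1 expr1n mulr1 in vp.
have /andP[_ w2] := norm2_near_unit v1 vp.
set w := pr 0%N v in vs vp w2.
have Fw : F w <= 144 * n%:R.
  rewrite leNgt; apply/negP => H; apply: nB; apply: (EB w vs w2) => /=.
  by rewrite /g -mulr_suml -/(F w); lra.
have Fd : F (vsub v w) <= sup A / 4.
  apply: le_trans (FS _) _.
  have S0 : 0 <= sup A.
    apply: (@le_trans _ _ (F v)); first by apply: sumr_ge0 => i _; exact: sqr_ge0.
    by have := FS v; rewrite v1 expr1n mul1r.
  have : norm2 (vsub v w) ^+ 2 <= 4^-1.
    have -> : 4^-1 = 2^-1 ^+ 2 :> R by field.
    by rewrite lerXn2r ?nnegrE ?norm2_ge0.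
  by move=> /(ler_wpM2r S0); lra.
have : F v <= 2 * F w + 2 * F (vsub v w).
  rewrite /F !mulr_sumr -big_split; apply: ler_sum => i _ /=.
  rewrite dotp_vsubl; set a := dotp v _; set b := dotp w _.
  have := sqr_ge0 (a - 2 * b); lra.
lra.
Qed.

Lemma halfspace_prob_unit (v : space R p) (c : R) : norm2 v = 1 -> halfspace_prob v c = (1 - e) * (1 - Phi c).
Proof.
move=> v1; apply: EFin_inj; rewrite -halfspace_probE EFinM -normal_itvcy.
have := QGZ v (measurable_itv `[c, +oo[).
rewrite (_ : [set r | _] = `[c, +oo[%classic); last first.
  by apply/seteqP; split=> t /=; rewrite v1 mul1r.
by move=> <-; congr (Q _); apply/seteqP; split=> t; rewrite /halfspace /= in_itv/= andbT.
Qed.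

(** Passing from v to its net point w costs a shift h of the level and a slab that
    is controlled by second moments. *)
Lemma halfspace_near (v w : space R p) (c h : R) : 0 < h ->
  halfspace v c `<=` halfspace w (c - h) `|` slab (vsub v w) h.
Proof.
move=> h0 y [Gy cy]; have [H|H] := leP (c - h) (dotp w (Z y)); first by left.
by right; rewrite /slab/= dotp_vsubl; apply: le_trans (ler_norm _); lra.
Qed.

Lemma cnt_slab_le (u : space R p) (h b : R) n (y : n.-tuple T) : 0 < h ->
  \sum_(i < n) dotp u (Z (tnth y i)) ^+ 2 <= b -> cnt (slab u h) y <= b / h ^+ 2.
Proof.
move=> h0 hb; rewrite ler_pdivlMr ?exprn_gt0// mulrC; apply: le_trans hb.
rewrite /cnt mulr_sumr; apply: ler_sum => i _; rewrite indicE.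
have [|_] := boolP (_ \in slab _ _); last by rewrite mulr0 sqr_ge0.
rewrite inE mulr1 => hi; rewrite -[leRHS]real_normK ?num_real//.
by rewrite lerXn2r ?nnegrE ?normr_ge0// ltW.
Qed.

Lemma halfspace_prob_near (v w : space R p) (c h r : R) : 0 < h -> norm2 v = 1 ->
  norm2 (vsub v w) <= r ->
  halfspace_prob w (c - h) <= (1 - e) * (1 - Phi c) + 2 * h + 8 * r ^+ 2 / h ^+ 2.
Proof.
move=> h0 v1 vw.
have -> : c - h = (c - 2 * h) + h by lra.
have H : (Q (halfspace w (c - 2 * h + h)) <= Q (halfspace v (c - 2 * h) `|` slab (vsub w v) h))%E.
  apply: le_measure; rewrite ?inE.
  - exact: measurable_halfspace.
  - by apply: measurableU; [exact: measurable_halfspace|exact: measurable_slab].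
  - by have := @halfspace_near w v (c - 2 * h + h) h h0; rewrite addrK.
have mv := measurable_halfspace v (c - 2 * h); have ms := measurable_slab (vsub w v) h.
have {}H := le_trans H (measureU2 Q mv ms).
have vw' : norm2 (vsub w v) <= r by rewrite norm2_vsubC.
have {}H := le_trans H (leeD (lexx _) (slab_le h0 vw')).
have {}H : ((halfspace_prob w (c - 2 * h + h))%:E <=
    (halfspace_prob v (c - 2 * h))%:E + (8 * r ^+ 2 / h ^+ 2)%:E)%E by rewrite -!halfspace_probE.
rewrite -EFinD lee_fin in H; apply: le_trans H _.
rewrite lerD2r halfspace_prob_unit//.
have /andP[_ P1] := @Phi_lip R (c - 2 * h) c ltac:(lra).
have /andP[e0 e1] := e01; nra.
Qed.

(** [chaining_bound] is applied at the level c - h.  The slabs left over by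
    [halfspace_near] contain O(n |v - w|^2 / h^2) sample points by
    [opnorm_event], which is O(n h) because |v - w| <= 8^-K / 2 and h = 4^-K. *)
Lemma uniform_halfspaces (x c : R) K n : 0 <= x -> (0 < p)%N -> (0 < K)%N ->
  let h : R := (2 ^- K) ^+ 2 in p%:R + x <= n%:R * h ^+ 2 ->
  exists B : set (n.-tuple T), [/\ measurable B,
    (iid_law Q n B <= (expR (- x) / 4)%:E)%E &
    forall y, ~ B y -> forall v, norm2 v = 1 ->
      cnt (halfspace v c) y <= n%:R * ((1 - e) * (1 - Phi c) + 270 * h)].
Proof.
move=> x0 p0 K0 h hn.
pose a : R := 2 ^- K; have hE : h = a ^+ 2 by [].
have a0 : 0 < a by rewrite invr_gt0 exprn_gt0.
have a1 : a <= 2^-1.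
  by rewrite lef_pV2 ?posrE ?exprn_gt0// -[leLHS]expr1 ler_eXn2l// ltr1n.
have h0 : 0 < h by rewrite hE exprn_gt0.
have ha : h <= a / 2 by rewrite hE; nra.
have n0 : 0 <= n%:R :> R by [].
have [s [pr hs]] := @sphere_nets R p p0.
have [B1 [mB1 PB1 EB1]] := chaining_bound (c - h) x0 p0 h0 ha hn hs (leqnSn K).
have h01 : 0 < h <= 1 by apply/andP; split=> //; lra.
have [B2 [mB2 PB2 EB2]] := opnorm_event x0 p0 h01 hn.
exists (B1 `|` B2); split; first exact: measurableU.
  apply: le_trans (measureU2 _ mB1 mB2) _; apply: le_trans (leeD PB1 PB2) _.
  rewrite -EFinD lee_fin; have := sum_geo16 R K; have := expR_ge0 (- x).
  set S := \sum_(_ < _) _; set E := expR _ => E0 S1; nra.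
move=> y nB v v1.
have nB1 : ~ B1 y by move=> ?; apply: nB; left.
have nB2 : ~ B2 y by move=> ?; apply: nB; right.
have H1 := EB1 y nB1 v v1.
have [_ /(_ v v1)[_ vw]] := hs K; rewrite -/a in vw.
set w := pr K v in H1 vw.
have H2 := EB2 y nB2 (vsub v w).
have vw2 : norm2 (vsub v w) ^+ 2 <= 4^-1 * a ^+ 6.
  have -> : 4^-1 * a ^+ 6 = (2^-1 * a ^+ 3) ^+ 2 by field.
  by rewrite lerXn2r ?nnegrE ?norm2_ge0// mulr_ge0// exprn_ge0// ltW.
have H3 : cnt (slab (vsub v w) h) y <= n%:R * (144 * h).
  apply: (@le_trans _ _ (576 * n%:R * (4^-1 * a ^+ 6) / h ^+ 2)).
    apply: cnt_slab_le => //; apply: le_trans H2 _.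
    have c0 : 0 <= 576 * n%:R :> R by lra.
    exact: ler_wpM2l c0 _ _ vw2.
  by rewrite hE le_eqVlt; apply/orP; left; apply/eqP; field; rewrite gt_eqF.
have H4 := halfspace_prob_near c h0 v1 vw.
have E4 : 8 * (2^-1 * a ^+ 3) ^+ 2 / h ^+ 2 = 2 * h.
  by rewrite hE; field; rewrite gt_eqF.
rewrite E4 in H4.
have H5 : \sum_(k < K) (24 + 16 * k.+1%:R) * h * 2 ^- k <= 112 * h.
  have -> : \sum_(k < K) (24 + 16 * k.+1%:R) * h * 2 ^- k =
     24 * h * (\sum_(k < K) 2 ^- k) + 16 * h * (\sum_(k < K) k.+1%:R * 2 ^- k).
    by rewrite !mulr_sumr -big_split/=; apply: eq_bigr => k _; ring.
  have := sum_geo R K; have := sum_arith_geo R K; nra.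
have H6 := @cnt_setU_le _ _ R _ _ _ n y (@halfspace_near v w c h h0).
apply: le_trans H6 _.
set S := \sum_(k < K) _ in H1 H5.
have H7 : n%:R * (halfspace_prob w (c - h) + 10 * h + S) <=
    n%:R * ((1 - e) * (1 - Phi c) + 126 * h).
  by rewrite ler_wpM2l//; lra.
lra.
Qed.

End chaining.

(** * Quadratic forms and the largest eigenvalue *)

Section quadratic_form.
Context {R : realType} {p : nat}.
Implicit Types (u v : space R p) (B S : 'M[R]_p).

Definition mulv B v : space R p := [tuple \sum_(j < p) B i j * tnth v j | i < p].

Lemma dotp_mulv B u v : dotp u (mulv B v) = dotp (mulv B^T u) v.
Proof.
rewrite /dotp; under eq_bigr do rewrite tnth_mktuple mulr_sumr.
rewrite exchange_big/=; apply: eq_bigr => j _.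
rewrite tnth_mktuple mulr_suml; apply: eq_bigr => i _.
by rewrite mxE; ring.
Qed.

Lemma mulvM B S v : mulv (B *m S) v = mulv B (mulv S v).
Proof.
apply: eq_from_tnth => i; rewrite !tnth_mktuple.
under eq_bigr do rewrite mxE mulr_suml.
rewrite exchange_big/=; apply: eq_bigr => j _.
by rewrite tnth_mktuple mulr_sumr; apply: eq_bigr => k _; rewrite mulrA.
Qed.

Lemma mulv1 v : mulv 1%:M v = v.
Proof.
apply: eq_from_tnth => i; rewrite tnth_mktuple (bigD1 i)//= big1 => [|j ji].
  by rewrite mxE eqxx mul1r addr0.
by rewrite mxE eq_sym (negbTE ji) mul0r.
Qed.

Lemma dotp_mulvBl a S u v : dotp u (mulv (a%:M - S) v) = a * dotp u v - dotp u (mulv S v).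
Proof.
rewrite /dotp mulr_sumr -sumrB; apply: eq_bigr => i _.
rewrite !tnth_mktuple; under eq_bigr do rewrite !mxE mulrBl.
rewrite sumrB mulrBr (bigD1 i)//= eqxx big1 ?addr0; last first.
  by move=> j ji; rewrite eq_sym (negbTE ji) mul0r.
by rewrite mulr1n; ring.
Qed.

Lemma mulv_bounded B : exists2 g : R, 0 < g & forall v, norm2 (mulv B v) <= g * norm2 v.
Proof.
pose rw i : space R p := [tuple B i j | j < p].
pose F := \sum_i norm2 (rw i) ^+ 2.
have F0 : 0 <= F by apply: sumr_ge0 => i _; exact: sqr_ge0.
exists (Num.sqrt F + 1); first by rewrite ltr_wpDl ?sqrtr_ge0.
move=> v; apply: (@le_trans _ _ (Num.sqrt F * norm2 v)); last first.
  by rewrite ler_wpM2r ?norm2_ge0// lerDl.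
rewrite -[norm2 v]ger0_norm ?norm2_ge0// -sqrtr_sqr -sqrtrM// ler_wsqrtr//.
rewrite /F mulr_suml; apply: ler_sum => i _.
rewrite -expr2 (_ : tnth (mulv B v) i = dotp (rw i) v) ?dotp_sqr_le//.
by rewrite tnth_mktuple; apply: eq_bigr => j _; rewrite tnth_mktuple.
Qed.

(** Evaluate the nonnegative form of B at v - g^-1 B v. *)
Lemma psd_image_le B g v : B^T = B -> (forall u, 0 <= dotp u (mulv B u)) ->
  0 < g -> (forall u, norm2 (mulv B u) <= g * norm2 u) ->
  norm2 (mulv B v) ^+ 2 <= g * dotp v (mulv B v).
Proof.
move=> Bs Bp g0 hg; set y := mulv B v.
have := Bp (vsub v (vscale g^-1 y)).
have sym a b : dotp a (mulv B b) = dotp b (mulv B a).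
  by rewrite dotp_mulv Bs dotpC.
set w := vsub _ _.
have -> : dotp w (mulv B w) =
   dotp v y - 2 * g^-1 * norm2 y ^+ 2 + g^-1 ^+ 2 * dotp y (mulv B y).
  rewrite {1}/w dotp_vsubl dotp_vscalel !(sym _ w).
  rewrite /w !dotp_vsubl !dotp_vscalel -/y norm2_sqr (sym v y).
  rewrite -/y; ring.
have h : dotp y (mulv B y) <= g * norm2 y ^+ 2.
  apply: le_trans (dotp_le_norm _ _) _.
  by rewrite expr2 mulrCA ler_wpM2l ?norm2_ge0.
move=> h1.
have h2 : g^-1 ^+ 2 * dotp y (mulv B y) <= g^-1 * norm2 y ^+ 2.
  apply: le_trans (ler_wpM2l (sqr_ge0 _) h) _.
  by rewrite expr2 -mulrA mulKf ?gt_eqF.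
rewrite -ler_pdivrMl//; lra.
Qed.

(** The supremum l of the quadratic form over the sphere is an eigenvalue.
    Otherwise l - S is positive semidefinite and invertible, so by
    [psd_image_le] its form is bounded away from 0 on the sphere, and l would not
    be the least upper bound. *)
Lemma quad_form_le S (M : R) : S^T = S -> (forall a, eigenvalue S a -> a < M) ->
  forall v, dotp v (mulv S v) <= M * norm2 v ^+ 2.
Proof.
move=> Ss hM v.
have sym a b : dotp a (mulv S b) = dotp b (mulv S a).
  by rewrite dotp_mulv Ss dotpC.
have qZ c u : dotp (vscale c u) (mulv S (vscale c u)) = c ^+ 2 * dotp u (mulv S u).
  by rewrite dotp_vscalel sym dotp_vscalel mulrA expr2.
have [v0|v0] := eqVneq (norm2 v) 0.
  by rewrite norm2_eq0// v0 expr0n mulr0.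
have {}v0 : 0 < norm2 v by rewrite lt_def v0 norm2_ge0.
have [g g0 hg] := mulv_bounded S.
pose A := [set dotp u (mulv S u) | u in [set u | norm2 u = 1]].
have Aub : ubound A g.
  move=> _ [u u1 <-]; apply: le_trans (dotp_le_norm _ _) _.
  by have := hg u; rewrite u1 mul1r mulr1.
have Ane : A !=set0.
  exists (dotp (vscale (norm2 v)^-1 v) (mulv S (vscale (norm2 v)^-1 v))).
  by exists (vscale (norm2 v)^-1 v) => //; exact: norm2_normalize.
set l := sup A.
have ql u : dotp u (mulv S u) <= l * norm2 u ^+ 2.
  have [u0|u0] := eqVneq (norm2 u) 0.
    by rewrite norm2_eq0// u0 expr0n mulr0.
  have {}u0 : 0 < norm2 u by rewrite lt_def u0 norm2_ge0.
  rewrite -ler_pdivrMr ?exprn_gt0// mulrC -exprVn -qZ.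
  apply: ub_le_sup; first by exists g.
  by exists (vscale (norm2 u)^-1 u) => //; exact: norm2_normalize.
apply: le_trans (ql v) _; rewrite ler_wpM2r ?sqr_ge0//.
have [/hM/ltW//|nev] := boolP (eigenvalue S l).
exfalso.
pose B := l%:M - S.
have Bs : B^T = B by rewrite /B linearB/= tr_scalar_mx Ss.
have Bp u : 0 <= dotp u (mulv B u).
  by rewrite dotp_mulvBl subr_ge0 -norm2_sqr.
have Bu : B \in unitmx.
  have -> : B = (-1) *: (S - l%:M) by rewrite scaleN1r opprB.
  rewrite unitmxZ ?unitrN1// -row_free_unit -kermx_eq0.
  by move: nev; rewrite /eigenvalue /eigenspace negbK.
have [b b0 hb] := mulv_bounded (invmx B).
have [c c0 hc] := mulv_bounded B.
have key u : norm2 u ^+ 2 <= b ^+ 2 * c * dotp u (mulv B u).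
  have h1 := hb (mulv B u); rewrite -mulvM mulVmx// mulv1 in h1.
  have h2 := psd_image_le u Bs Bp c0 hc.
  rewrite -mulrA; apply: (@le_trans _ _ (b ^+ 2 * norm2 (mulv B u) ^+ 2)).
    by rewrite -exprMn lerXn2r ?nnegrE ?mulr_ge0 ?norm2_ge0// ltW.
  by rewrite ler_wpM2l ?sqr_ge0.
have k0 : 0 < b ^+ 2 * c by rewrite mulr_gt0 ?exprn_gt0.
have : l <= l - (b ^+ 2 * c)^-1.
  apply: ge_sup => // _ [u u1 <-].
  have := key u; rewrite u1 expr1n dotp_mulvBl -norm2_sqr u1 expr1n mulr1.
  rewrite -ler_pdivrMl// mulr1; lra.
have : 0 < (b ^+ 2 * c)^-1 by rewrite invr_gt0.
lra.
Qed.

End quadratic_form.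

(** * Labelled observations from the contaminated law *)

Section labelled_model.
Context {R : realType}.
Variables (p : nat) (e : R) (G : probability (space R p) R).
Hypothesis e01 : 0 <= e <= 1.
Local Notation N := (normal_prob (0 : R) 1).

Local Notation labelled := (bool * (space R p * space R p))%type.

(** One labelled observation: the label (true when genuine), the standard normal
    vector behind a genuine observation, and the value taken by a contaminated
    one, all independent. *)
Definition mixture : probability labelled R :=
  (bernoulli_prob (1 - e) \x (iid_law N p \x G))%E.

Lemma mixtureE (C : set bool) (A B : set (space R p)) : measurable A -> measurable B ->
  mixture (C `*` (A `*` B)) =
  (bernoulli_prob (1 - e) C * (iid_law N p A * G B))%E.
Proof.
move=> mA mB.
apply: etrans (product_measure1E _ _ _ _) _ => //; first exact: measurableX.
by congr (_ * _)%E; apply: product_measure1E.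
Qed.

Lemma bernoulli_true : bernoulli_prob (1 - e) [set true] = (1 - e)%:E.
Proof.
have p01 : 0 <= 1 - e <= 1 by move: e01 => /andP[? ?]; apply/andP; split; lra.
rewrite bernoulli_probE//.
by rewrite !diracE mem_set// memNset//= mule0 adde0 mule1.
Qed.

Lemma bernoulli_false : bernoulli_prob (1 - e) [set false] = e%:E.
Proof.
have p01 : 0 <= 1 - e <= 1 by move: e01 => /andP[? ?]; apply/andP; split; lra.
rewrite bernoulli_probE//.
rewrite !diracE memNset// mem_set//= mule0 add0e mule1.
by congr _%:E; rewrite /unstable.onem; lra.
Qed.

Definition genuine : set labelled := [set t : labelled | t.1].

Lemma genuineE : genuine = [set true] `*` (setT `*` setT).
Proof. by apply/seteqP; split=> [[[] [? ?]]|[[] [? ?]]]//= [] ->. Qed.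

Lemma measurable_genuine : measurable genuine.
Proof. by rewrite genuineE; apply: measurableX => //; exact: measurableX. Qed.

Lemma mixture_genuineC : mixture (~` genuine) = e%:E.
Proof.
have -> : ~` genuine = [set false] `*` (setT `*` setT).
  apply/seteqP; split=> [[b [z y]] h|[b [z y]] [/= -> _]]; last by [].
  by split=> //=; case: b h => // h; case: h.
by rewrite mixtureE// bernoulli_false !probability_setT !mule1.
Qed.

Definition gauss_part (t : labelled) : space R p := t.2.1.

Lemma measurable_gauss_part : measurable_fun setT gauss_part.
Proof. by apply: measurableT_comp => //. Qed.

Lemma measurable_dotp_preimage (w : space R p) (B : set (measurableTypeR R)) :
  measurable B -> measurable [set z : space R p | B (dotp w z)].
Proof. by move=> mB; rewrite -[X in measurable X]setTI; exact: measurable_dotp. Qed.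

Lemma mixture_dotp (w : space R p) (B : set (measurableTypeR R)) : measurable B ->
  mixture [set t | B (dotp w (gauss_part t))] = N [set r | B (norm2 w * r)].
Proof.
move=> mB; have mA := measurable_dotp_preimage w mB.
rewrite -normal_dotp//.
have -> : [set t | B (dotp w (gauss_part t))] =
    setT `*` ([set z : space R p | B (dotp w z)] `*` setT).
  by apply/seteqP; split=> [[b [z y]]|[b [z y]]]//= [_ []].
by rewrite mixtureE// !probability_setT mule1 mul1e.
Qed.

Lemma mixture_genuine_dotp (w : space R p) (B : set (measurableTypeR R)) : measurable B ->
  mixture [set t | genuine t /\ B (dotp w (gauss_part t))] =
  ((1 - e)%:E * N [set r | B (norm2 w * r)%R])%E.
Proof.
move=> mB; have mA := measurable_dotp_preimage w mB.
rewrite -normal_dotp//.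
have -> : [set t | genuine t /\ B (dotp w (gauss_part t))] =
    [set true] `*` ([set z : space R p | B (dotp w z)] `*` setT).
  by apply/seteqP; split=> [[b [z y]]|[b [z y]]]//=; rewrite /genuine/=; [case=> -> ?|case=> -> [? _]].
by rewrite mixtureE// bernoulli_true !probability_setT mule1.
Qed.

Definition observe (theta : space R p) (A : 'M[R]_p) (t : labelled) : space R p :=
  if t.1 then affine theta A t.2.1 else t.2.2.

Lemma measurable_affine_map (theta : space R p) (A : 'M[R]_p) :
  measurable_fun setT (affine theta A).
Proof.
apply/measurable_fun_tnthP => i.
rewrite (_ : _ \o _ = fun x => tnth theta i + \sum_(j < p) A i j * tnth x j); last first.
  by apply/funext => x /=; rewrite tnth_mktuple.
apply: measurable_funD => //; apply: measurable_sum => j; apply: measurable_funM => //.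
exact: measurable_tnth.
Qed.

Lemma measurable_observe (theta : space R p) (A : 'M[R]_p) :
  measurable_fun setT (observe theta A).
Proof.
apply: measurable_fun_ifT.
- exact: measurable_fst.
- apply: measurableT_comp; first exact: measurable_affine_map.
  exact: measurable_gauss_part.
- by apply: measurableT_comp.
Qed.

(** This coupling turns contamination into labels, so that the genuine and the
    contaminated part of one sample can be treated apart. *)
Lemma mixture_observe (theta : space R p) (A : 'M[R]_p) (P0 P : probability (space R p) R) :
  (forall B, measurable B -> P0 B = iid_law N p (affine theta A @^-1` B)) ->
  (forall B, measurable B -> P B = ((1 - e)%:E * P0 B + e%:E * G B)%E) ->
  forall B, measurable B -> P B = mixture (observe theta A @^-1` B).
Proof.
move=> hP0 hP B mB; rewrite hP// hP0//.
have mA : measurable (affine theta A @^-1` B).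
  by rewrite -[X in measurable X]setTI; exact: measurable_affine_map.
have -> : observe theta A @^-1` B =
   ([set true] `*` ((affine theta A @^-1` B) `*` setT)) `|`
   ([set false] `*` (setT `*` B)).
  apply/seteqP; split=> [[[] [z y]]|[[] [z y]]]/=; rewrite /observe/=.
  - by left.
  - by right.
  - by case=> [[_ []]|[]].
  - by case=> [[]|[_ []]].
set X := [set true] `*` _; set Y := [set false] `*` _.
have mX : measurable X by apply: measurableX => //; exact: measurableX.
have mY : measurable Y by apply: measurableX => //; exact: measurableX.
have XY : X `&` Y = set0.
  by apply/seteqP; split=> // -[[] [z y]] /= [[? _] [? _]].
transitivity (mixture X + mixture Y)%E; last exact/esym/measureU.
by rewrite !mixtureE// bernoulli_true bernoulli_false !probability_setT mule1 mul1e.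
Qed.

End labelled_model.

(** * From uniform deviations to the error of the median *)

Lemma empiricalE (d : measure_display) (T : measurableType d) (R : realType) n
  (x : n.-tuple T) (B : set T) :
  empirical x B = (n%:R^-1 * cnt B x)%:E :> \bar R.
Proof.
rewrite /empirical EFinM; congr (_ * _)%E.
by rewrite /cnt -sumEFin; apply: eq_bigr => i _; rewrite diracE indicE.
Qed.

Lemma cnt_map (d d' : measure_display) (T : measurableType d) (T' : measurableType d')
  (R : realType) (f : T -> T') n (y : n.-tuple T) (B : set T') :
  cnt B (map_tuple f y) = cnt (f @^-1` B) y :> R.
Proof.
apply: eq_bigr => i _; rewrite tnth_map !indicE; congr (_%:R).
Qed.

Lemma cnt_setT_le (d : measure_display) (T : measurableType d) (R : realType) n
  (y : n.-tuple T) (A B C : set T) : (A `|` B) `|` C = setT ->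
  n%:R <= cnt A y + cnt B y + cnt C y :> R.
Proof.
move=> ABC; have -> : n%:R = \sum_(i < n) 1 :> R by rewrite sumr_const card_ord.
rewrite /cnt -!big_split; apply: ler_sum => i _ /=; rewrite !indicE.
have : ((A `|` B) `|` C) (tnth y i) by rewrite ABC.
by case=> [[|]|] H; rewrite (mem_set H) ?lerDr ?lerDl//=; do ?case: (_ \in _) => /=; lra.
Qed.

Lemma depth_lower_arith (R : realType) (m e h a b c : R) :
  a <= m * (e + 10 * h) -> b <= m * ((1 - e) * (1 - 2^-1) + 270 * h) ->
  m <= a + b + c -> m * (1 - e - 10 * h - (1 - e) / 2 - 270 * h) <= c.
Proof. lra. Qed.

Lemma depth_upper_arith (R : realType) (m e h a b c q : R) : 0 < m ->
  a <= m * (e + 10 * h) -> b <= m * ((1 - e) * (1 - q) + 270 * h) ->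
  c <= a + b -> m * (1 - e - 10 * h - (1 - e) / 2 - 270 * h) <= c ->
  (1 - e) * (q - 2^-1) <= e + 560 * h.
Proof.
move=> m0 ha hb hc low.
have H : m * (1 - e - 10 * h - (1 - e) / 2 - 270 * h) <=
    m * (e + 10 * h + ((1 - e) * (1 - q) + 270 * h)) by lra.
by rewrite (ler_pM2l m0) in H; lra.
Qed.

Section depth_argument.
Context {R : realType} {p : nat}.
Implicit Types (u v theta z : space R p) (S A : 'M[R]_p).

Lemma dotp_affine u theta A z :
  dotp u (affine theta A z) = dotp u theta + dotp (mulv A^T u) z.
Proof.
rewrite -dotp_mulv /dotp -big_split/=; apply: eq_bigr => i _.
by rewrite !tnth_mktuple mulrDr.
Qed.

Lemma norm2_mulv_tr A u : norm2 (mulv A^T u) ^+ 2 = dotp u (mulv (A *m A^T) u).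
Proof. by rewrite norm2_sqr -dotp_mulv mulvM. Qed.

Lemma posdefmx_dotp S u : posdefmx S -> norm2 u = 1 -> 0 < dotp u (mulv S u).
Proof.
move=> [_ Sp] u1; pose c : 'cV[R]_p := \col_i tnth u i.
have c0 : c != 0.
  apply/eqP => c0; have : dotp u u = 0.
    apply: big1 => i _; have /matrixP/(_ i 0) := c0; rewrite !mxE => ->.
    by rewrite mul0r.
  by rewrite -norm2_sqr u1 expr1n => /eqP; rewrite oner_eq0.
have := Sp c c0; rewrite -mulmxA mxE.
congr (0 < _); apply: eq_bigr => i _; rewrite !mxE tnth_mktuple; congr (_ * _).
by apply: eq_bigr => j _; rewrite mxE.
Qed.

Lemma mulv_tr_bounds (M : R) S A u : calF p M S -> A *m A^T = S -> norm2 u = 1 ->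
  0 < norm2 (mulv A^T u) <= Num.sqrt M.
Proof.
move=> [Sp SM] AS u1.
have h := norm2_mulv_tr A u; rewrite AS in h.
have S0 := posdefmx_dotp Sp u1.
have SM' := quad_form_le Sp.1 SM u; rewrite u1 expr1n mulr1 in SM'.
apply/andP; split.
  by rewrite lt_def norm2_ge0 andbT; apply/eqP => z0; move: S0; rewrite -h z0 expr0n ltxx.
by rewrite -[leLHS]ger0_norm ?norm2_ge0// -sqrtr_sqr ler_wsqrtr// h.
Qed.

(** The deterministic core: compare the depths of theta and of the median.  At
    theta, in every direction u, at most the contaminated points and the genuine
    ones with v.Z >= 0 are missed, where v is the normalised A^T u.  At the
    median, in the direction u from the median to theta, the genuine points
    counted have v.Z >= s for v opposite to A^T u.  The constant
    560 = 2 * 10 + 2 * 270 collects the four deviation terms. *)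
Lemma tukey_error_bound n (M e h s : R) theta S A (That : n.-tuple (space R p) -> space R p)
    (y : n.-tuple (bool * (space R p * space R p))) :
  (0 < n)%N -> 0 <= s -> calF p M S -> A *m A^T = S -> is_tukey_median That ->
  let H := halfspace (@genuine R p) (@gauss_part R p) in
  cnt (~` @genuine R p) y <= n%:R * (e + 10 * h) ->
  (forall v, norm2 v = 1 -> cnt (H v 0) y <= n%:R * ((1 - e) * (1 - Phi 0) + 270 * h)) ->
  (forall v, norm2 v = 1 -> cnt (H v s) y <= n%:R * ((1 - e) * (1 - Phi s) + 270 * h)) ->
  e + 560 * h < (1 - e) * (Phi s - 2^-1) ->
  norm2 (vsub (That (map_tuple (observe theta A) y)) theta) <= Num.sqrt M * s.
Proof.
move=> n0 s0 SF AS [_ That_max] H bad H0 Hs gap.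
set f := observe theta A; set x := map_tuple f y.
have nR : 0 < n%:R :> R by rewrite ltr0n.
rewrite Phi0 in H0.
have lower u : norm2 u = 1 ->
    ((1 - e - 10 * h - (1 - e) / 2 - 270 * h)%:E <=
     empirical x [set z | (dotp u z <= dotp u theta)%R])%E.
  move=> u1; rewrite empiricalE lee_fin cnt_map.
  set w := mulv A^T u; have /andP[w0 _] := mulv_tr_bounds SF AS u1.
  pose v := vscale (norm2 w)^-1 w.
  have v1 : norm2 v = 1 by exact: norm2_normalize.
  rewrite ler_pdivlMl//.
  apply: (depth_lower_arith bad (H0 v v1)).
  apply: cnt_setT_le; apply/seteqP; split=> // t _.
  have [gt|gt] := pselect (genuine t); last by left; left.
  have [c|c] := leP 0 (dotp v (gauss_part t)); first by left; right.
  right; rewrite /f /= /observe; move: (gt); rewrite /genuine/= => ->.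
  rewrite dotp_affine gerDl ltW//.
  by move: c; rewrite dotp_vscalel pmulr_rlt0 ?invr_gt0.
rewrite leNgt; apply/negP => far.
set D := norm2 _ in far.
have D0 : 0 < D by apply: le_lt_trans far; rewrite mulr_ge0 ?sqrtr_ge0.
pose u := vscale D^-1 (vsub theta (That x)).
have u1 : norm2 u = 1.
  by rewrite /u /D norm2_vsubC; apply: norm2_normalize; rewrite norm2_vsubC.
have low : ((1 - e - 10 * h - (1 - e) / 2 - 270 * h)%:E <= tukey_depth theta (empirical x))%E.
  by apply/ereal_infP => _ [w w1 <-]; exact: lower.
have up : (tukey_depth (That x) (empirical x) <=
   empirical x [set z | (dotp u z <= dotp u (That x))%R])%E.
  by apply: ereal_inf_lbound; exists u.
have := le_trans low (le_trans (That_max x theta) up).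
rewrite empiricalE lee_fin cnt_map ler_pdivlMl// => key.
set w := mulv A^T u; have /andP[w0 wM] := mulv_tr_bounds SF AS u1.
pose v := vscale (- (norm2 w)^-1) w.
have v1 : norm2 v = 1.
  by rewrite norm2_vscale normrN gtr0_norm ?invr_gt0// mulVf// gt_eqF.
apply/negP: gap; rewrite -leNgt.
apply: (depth_upper_arith nR bad (Hs v v1) _ key).
  apply: cnt_setU_le => t b.
  have [gt|gt] := pselect (genuine t); last by left.
  right; split=> //.
  move: b; rewrite /f /= /observe; move: (gt); rewrite /genuine/= => ->.
  rewrite dotp_affine -lerBrDl -dotp_vsubr.
  have -> : dotp u (vsub (That x) theta) = - D.
    rewrite /u dotp_vscalel dotp_vsubl dotp_vsubr dotp_vsubr.
    have : D ^+ 2 = dotp (vsub (That x) theta) (vsub (That x) theta) by rewrite norm2_sqr.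
    rewrite dotp_vsubl !dotp_vsubr => hD; apply: (mulfI (lt0r_neq0 D0)).
    by rewrite mulrA mulfV ?gt_eqF// mul1r mulrN -expr2 hD; ring.
  rewrite -/w /gauss_part => c.
  rewrite dotp_vscalel mulNr -mulrN mulrC ler_pdivlMr//.
  have : s * norm2 w <= Num.sqrt M * s by rewrite mulrC ler_wpM2r.
  lra.
Qed.

End depth_argument.

(** * The probability bound *)

Lemma measurable_error_event (R : realType) p n (That : n.-tuple (space R p) -> space R p)
    (theta : space R p) (r : R) : measurable_fun setT That ->
  measurable [set x | norm2 (vsub (That x) theta) ^+ 2 <= r].
Proof.
move=> mT; rewrite -[X in measurable X]setTI; apply: measurable_fun_le => //.
rewrite (_ : (fun x => norm2 _ ^+ 2) =
   (fun x => \sum_(i < p) (tnth (That x) i - tnth theta i) ^+ 2)); last first.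
  apply/funext => x; rewrite norm2_sqr; apply: eq_bigr => i _.
  by rewrite tnth_mktuple expr2.
apply: measurable_sum => i; apply: measurable_funX; apply: measurable_funB => //.
by apply: (@measurableT_comp _ _ _ _ _ _ (fun t => tnth t i) _ That) => //; exact: measurable_tnth.
Qed.

(** The rate is rounded up to h = 4^-K, with q <= h^2 <= 16 q, so that the chain
    can stop at the radius 8^-K = h^(3/2) exactly. *)
Lemma dyadic_bracket (R : realType) (q : R) : 0 < q <= 16^-1 ->
  exists2 K, (0 < K)%N & q <= ((2 ^- K) ^+ 2) ^+ 2 <= 16 * q.
Proof.
move=> /andP[q0 q1].
have [k kq] : exists k, 16 ^- k < q.
  exists (Num.bound q^-1); rewrite invf_plt ?posrE ?exprn_gt0//.
  apply: lt_trans (archi_boundP _) _; first by rewrite invr_ge0 ltW.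
  by rewrite -natrX ltr_nat ltn_expl.
have E j : ((2 ^- j) ^+ 2) ^+ 2 = 16 ^- j :> R.
  rewrite -exprM exprVn -exprM mulnC exprM (_ : 2 ^+ (2 * 2) = 16)//.
  by rewrite -natrX.
have exk : exists k, (16 ^- k < q :> R) by exists k.
case: (ex_minnP exk) => m mq mmin.
case: m mq mmin => [|K] mq mmin; first by move: mq; rewrite expr0 invr1; lra.
have qK : q <= 16 ^- K.
  by rewrite leNgt; apply/negP => /mmin; rewrite ltnn.
exists K.
  case: K mq qK mmin => // mq _ _; move: mq; rewrite expr1; lra.
rewrite E qK /=; move: mq; rewrite exprS invfM; lra.
Qed.

Lemma deviation_probability (R : realType) (M eps x s : R) (p n K : nat)
  (That : n.-tuple (space R p) -> space R p) (theta : space R p) (S : 'M[R]_p)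
  (P0 P : probability (space R p) R) (r : R) :
  0 < M -> 0 <= eps <= 1 -> 0 <= x -> 0 <= s -> (0 < p)%N -> (0 < n)%N -> (0 < K)%N ->
  let h : R := (2 ^- K) ^+ 2 in
  p%:R + x <= n%:R * h ^+ 2 ->
  eps + 560 * h < (1 - eps) * (Phi s - 2^-1) ->
  M * s ^+ 2 <= r ->
  is_tukey_median That -> calF p M S -> is_mvnormal theta S P0 -> contamination eps P0 P ->
  ((1 - 2 * expR (- x))%:E <=
   iid_law P n [set y | (norm2 (vsub (That y) theta) ^+ 2 <= r)%R])%E.
Proof.
move=> M0 e01 x0 s0 p0 n0 K0 h hn gap hr TM SF [A AS hP0] [G hP].
have mE := measurable_error_event theta r TM.1.
rewrite (iid_law_map (measurable_observe theta A) (mixture_observe e01 hP0 hP) mE).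
set Q := mixture eps G; set T' := [set _ | _].
have mT' : measurable T'.
  by rewrite -[X in measurable X]setTI; exact: (measurable_map_tuple (measurable_observe theta A)).
have mG := @measurable_genuine R p.
have mZ := @measurable_gauss_part R p.
have u c := uniform_halfspaces mG mZ (mixture_dotp eps G) (mixture_genuine_dotp G e01) e01 c x0 p0 K0 hn.
have [B0 [mB0 PB0 EB0]] := u 0.
have [B1 [mB1 PB1 EB1]] := u s.
pose L := [set y : n.-tuple _ | n%:R * (eps + 10 * h) <= cnt (~` @genuine R p) y].
have a1 : 2 ^- K <= 2^-1 :> R.
  by rewrite lef_pV2 ?posrE ?exprn_gt0// -[leLHS]expr1 ler_eXn2l// ltr1n.
have a0 : 0 < 2 ^- K :> R by rewrite invr_gt0 exprn_gt0.
have h01 : 0 <= h <= 2^-1 by apply/andP; split; rewrite /h; nra.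
have mL : measurable L.
  rewrite -[X in measurable X]setTI; apply: measurable_fun_le => //.
  by apply: measurable_cnt; exact: measurableC.
have PL : (iid_law Q n L <= (expR (- x))%:E)%E.
  have := hoeffding_event Q n (measurableC mG) h01.
  rewrite mixture_genuineC//= => /le_trans; apply.
  rewrite lee_fin ler_expR; have : 0 <= p%:R :> R by []. 
  lra.
have sub : ~` T' `<=` (B0 `|` B1) `|` L.
  move=> y; apply: contra_notP => nB; rewrite /T' /=.
  have nB0 : ~ B0 y by move=> ?; apply: nB; left; left.
  have nB1 : ~ B1 y by move=> ?; apply: nB; left; right.
  have nL : ~ L y by move=> ?; apply: nB; right.
  have bad : cnt (~` @genuine R p) y <= n%:R * (eps + 10 * h).
    by rewrite leNgt; apply/negP => ?; apply: nL; exact: ltW.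
  have := tukey_error_bound theta n0 s0 SF AS TM bad (EB0 y nB0) (EB1 y nB1) gap.
  move=> H; apply: le_trans hr.
  have -> : M * s ^+ 2 = (Num.sqrt M * s) ^+ 2 by rewrite exprMn sqr_sqrtr// ltW.
  by rewrite lerXn2r// nnegrE ?norm2_ge0// mulr_ge0 ?sqrtr_ge0.
have mB01 := measurableU _ _ mB0 mB1.
have mC : measurable (~` T') by exact: measurableC.
have H : (iid_law Q n (~` T') <= (2 * expR (- x))%:E)%E.
  apply: (@le_trans _ _ (iid_law Q n ((B0 `|` B1) `|` L))).
    by apply: le_measure => //; rewrite inE//; exact: measurableU.
  apply: le_trans (measureU2 _ mB01 mL) _.
  apply: le_trans (leeD (measureU2 _ mB0 mB1) PL) _.
  apply: le_trans (leeD (leeD PB0 PB1) (lexx _)) _.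
  rewrite -!EFinD lee_fin; have := expR_ge0 (- x); lra.
have -> : T' = ~` (~` T') by rewrite setCK.
rewrite probability_setC//.
have F : iid_law Q n (~` T') \is a fin_num by exact: fin_num_measure.
move: H; rewrite -(fineK F) -EFinB !lee_fin; lra.
Qed.

Lemma normal_pdf_gt0 (R : realType) (t : R) : 0 < normal_pdf 0 1 t.
Proof.
rewrite normal_pdf01E mulr_gt0 ?expR_gt0// invr_gt0.
by rewrite sqrtr_gt0 pmulrn_rgt0 ?pi_gt0.
Qed.

(** B_L eps solves (1 - eps) (Phi b - 1/2) = eps.  Going further by L h, within the
    interval where the density is at least its value at B_L eps' + 1, adds
    at least (1 - eps) 900 h >= 600 h. *)
Lemma bias_gap (R : realType) (eps eps' h L : R) : 0 <= eps <= eps' -> eps' < 3^-1 -> 0 < h ->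
  0 <= L -> 900 <= L * normal_pdf 0 1 (B_L eps' + 1) -> L * h <= 1 ->
  eps + 560 * h < (1 - eps) * (Phi (B_L eps + L * h) - 2^-1).
Proof.
move=> /andP[e0 ee] e1 h0 L0 Lk Lh.
set s := B_L eps + L * h.
have Lh0 : 0 <= L * h by rewrite mulr_ge0// ltW.
have he : 0 <= eps < 3^-1 by rewrite e0 (le_lt_trans ee).
have he' : 0 <= eps' < 3^-1 by rewrite (le_trans e0).
have [B0 BE] := B_L_spec he.
have [B0' _] := B_L_spec he'.
have BB : B_L eps <= B_L eps' by apply: B_L_le => //; rewrite e0.
have H1 : normal_pdf 0 1 (B_L eps' + 1) * (s - B_L eps) <= Phi s - Phi (B_L eps).
  by apply: Phi_ge; rewrite /s; lra.
have H2 : 900 * h <= normal_pdf 0 1 (B_L eps' + 1) * (s - B_L eps).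
  by rewrite /s addrAC subrr add0r mulrA (mulrC _ L) ler_pM2r.
have {H1 H2} H : 900 * h <= Phi s - Phi (B_L eps) := le_trans H2 H1.
have e23 : 2 / 3 <= 1 - eps by lra.
have HB : (1 - eps) * Phi (B_L eps) = (1 + eps) / 2.
  by rewrite BE; field; rewrite gt_eqF//; lra.
have h9 : 0 <= 900 * h by lra.
have H3 : 2 / 3 * (900 * h) <= (1 - eps) * (Phi s - Phi (B_L eps)).
  by apply: ler_pM => //; lra.
by rewrite mulrBr HB in H3; rewrite mulrBr; lra.
Qed.

Theorem lemma7 (R : realType) (M eps' : R) (hM : 0 < M)
    (heps' : 0 < eps' < 3^-1) :
  exists c Ct : R, [/\ 0 < c, 0 < Ct &
    forall (eps delta : R) (p n : nat),
      0 <= eps <= eps' -> 0 < delta < 2^-1 -> (0 < p)%N -> (0 < n)%N ->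
      (p%:R + ln (delta^-1)) / n%:R <= c ->
      forall That : n.-tuple (space R p) -> space R p,
        is_tukey_median That ->
        ((1 - 2 * delta)%R%:E <=
         ereal_inf [set r : \bar R |
           exists (theta : space R p) (S : 'M[R]_p)
                  (P0 P : probability (space R p) R),
             [/\ calF p M S, is_mvnormal theta S P0,
                 contamination eps P0 P &
                 r = iid_law P n
                   [set x : n.-tuple (space R p) |
                    (norm2 (vsub (That x) theta) ^+ 2 <=
                    Ct * (Num.max (p%:R / n%:R) (B_L eps ^+ 2)
                          + ln (delta^-1) / n%:R))%R]]])%E].
Proof.
case/andP: heps' => e'0 e'1.
(* The density bound must not depend on eps; B_L is increasing, so the interval
   up to B_L eps' + 1 contains all the levels that occur. *)
pose k : R := normal_pdf 0 1 (B_L eps' + 1).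
have k0 : 0 < k by exact: normal_pdf_gt0.
have k1 : k <= 1 by exact: normal_pdf_le1.
pose L : R := 900%:R / k.
have Lk : L * k = 900%:R by rewrite divfK// gt_eqF.
have L1 : 1 <= L by rewrite ler_pdivlMr// mul1r (le_trans k1)// ler1n.
have L0 : 0 < L by exact: lt_le_trans L1.
clearbody L.
have L20 : 0 < 16 * L ^+ 2 by rewrite mulr_gt0// exprn_gt0.
exists (16 * L ^+ 2)^-1, (2 * M * (1 + 16 * L ^+ 2)); split.
- by rewrite invr_gt0.
- by rewrite mulr_gt0 ?mulr_gt0// ltr_pwDl// ltW.
move=> eps delta p n he /andP[d0 d1] p0 n0 hc That TM.
have nR : 0 < n%:R :> R by rewrite ltr0n.
have pR : 0 < p%:R :> R by rewrite ltr0n.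
set x := ln delta^-1 in hc *.
have x0 : 0 <= x by rewrite ln_ge0// invf_ge1//; lra.
have dE : delta = expR (- x) by rewrite /x lnV ?posrE// opprK lnK.
set q := (p%:R + x) / n%:R in hc.
have q0 : 0 < q by rewrite divr_gt0// ltr_wpDr.
have q16 : q <= 16^-1.
  apply: le_trans hc _; by rewrite lef_pV2 ?posrE// ler_peMr// exprn_ege1.
have [|K K0 /andP[qh hq]] := @dyadic_bracket R q; first by rewrite q0 q16.
set h : R := (2 ^- K) ^+ 2 in qh hq.
have h0 : 0 < h by rewrite exprn_gt0// invr_gt0 exprn_gt0.
have hn : p%:R + x <= n%:R * h ^+ 2.
  by rewrite mulrC -ler_pdivrMr.
have Lh : L * h <= 1.
  have L2h : (L * h) ^+ 2 <= 1.
    rewrite exprMn; apply: (@le_trans _ _ (L ^+ 2 * (16 * q))).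
      by rewrite ler_wpM2l ?sqr_ge0.
    by rewrite mulrCA mulrA -ler_pdivlMl// mulr1.
  by rewrite -(@ler_pXn2r _ 2%N) ?nnegrE ?expr1n// mulr_ge0// ltW.
have Lk' : 900 <= L * k by rewrite Lk.
have gap := bias_gap he e'1 h0 (ltW L0) Lk' Lh.
case/andP: he => e0 ee.
have [|B0 _] := @B_L_spec R eps; first by rewrite e0 (le_lt_trans ee).
set s := B_L eps + L * h in gap.
apply: le_ereal_inf_tmp => _ [theta [S [P0 [P [SF hP0 hP ->]]]]].
rewrite dE; apply: (deviation_probability hM _ x0 _ p0 n0 K0 hn gap _ TM SF hP0 hP).
- by apply/andP; split; lra.
- by rewrite addr_ge0// mulr_ge0// ltW.
- set m := Num.max _ _.
  have m1 : p%:R / n%:R <= m by rewrite le_max lexx.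
  have m2 : B_L eps ^+ 2 <= m by rewrite le_max lexx orbT.
  have qm : q <= m + x / n%:R by rewrite /q mulrDl lerD2r.
  have xn : 0 <= x / n%:R by rewrite divr_ge0// ltW.
  apply: (@le_trans _ _ (M * (2 * (B_L eps ^+ 2 + (L * h) ^+ 2)))).
    rewrite ler_pM2l// /s; have := sqr_ge0 (B_L eps - L * h); lra.
  rewrite (mulrC 2 M) -!mulrA ler_pM2l// ler_pM2l//.
  have : (L * h) ^+ 2 <= 16 * L ^+ 2 * (m + x / n%:R).
    rewrite exprMn [16 * _]mulrC -[leRHS]mulrA ler_wpM2l ?sqr_ge0//.
    by apply: le_trans hq _; rewrite ler_pM2l.
  lra.
Qed.
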